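(* Let $V$ be a reduced $n\times(n+r)$ $F$-matrix with $r\le3$. If $\gamma\subseteq\mathrm{Mov}(V)$ is a maxbord chamber of the secondary fan of $V$, then $\gamma$ is simplicial, the associated fan $\Sigma_\gamma$ admits precisely $r$ primitive collections, and at least one of them is numerically effective.
   Context: For an integer matrix $A$ with $m$ columns and $I\subseteq\{1,\dots,m\}$, $A_I$ (resp. $A^I$) is the submatrix of the columns indexed by $I$ (resp. by the complement of $I$); $\langle A\rangle$ is the convex cone generated by the columns. An $F$-matrix is an $n\times(n+r)$ integer matrix $V=(v_1,\dots,v_{n+r})$ of rank $n$ with $\langle V\rangle=\mathbb{R}^n$, all columns nonzero, and no column a positive real multiple of another one; it is reduced if every column has coprime entries. The Gale dual $Q=\mathcal{G}(V)$ has as rows a $\mathbb{Z}$-basis of $\{x\in\mathbb{Z}^{n+r}:Vx^T=0\}$ and is chosen with nonnegative entries and in row echelon form. Let $\mathcal{Q}=\langle Q\rangle\subset\mathbb{R}^r$. A chamber of the secondary fan is a cone which is minimal, with respect to inclusion, among the $r$-dimensional cones obtained as intersections of simplicial cones generated by columns of $Q$. Set $\mathrm{Mov}(V)=\bigcap_i\langle Q^{\{i\}}\rangle$. For a chamber $\gamma\subseteq\mathrm{Mov}(V)$, $\Sigma_\gamma$ is the simplicial complete fan with maximal cones $\langle V^J\rangle$, for $|J|=r$, $\det Q_J\ne0$, $\gamma\subseteq\langle Q_J\rangle$; $X(\Sigma_\gamma)$ is projective. $\gamma$ is maxbord if there is a hyperplane $H$ supporting $\mathcal{Q}$ with $\dim(H\cap\mathcal{Q})=r-1$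 and $\dim(\gamma\cap H)=r-1$ (for $r=1$ every chamber is maxbord). A cone is simplicial if it is generated by linearly independent vectors. A primitive collection for a fan $\Sigma$ with rays $\langle v_1\rangle,\dots,\langle v_{n+r}\rangle$ is a set $\mathcal{P}$ of rays which is not contained in a single cone of $\Sigma$ while every proper subset is. The vector $\sum_{\langle v_j\rangle\in\mathcal{P}}v_j$ lies in the relative interior of a unique cone $\sigma\in\Sigma$, giving a unique relation $\sum_{\langle v_j\rangle\in\mathcal{P}}v_j-\sum_{\rho\in\sigma(1)}c_\rho v_\rho=0$ with rational $c_\rho>0$. $\mathcal{P}$ is numerically effective (nef) if all the coefficients of the vectors $v_1,\dots,v_{n+r}$ in this relation are $\ge0$. *)

(* Defs.v *)
From mathcomp Require Import all_boot all_order all_algebra all_fingroup.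
From mathcomp Require Import boolp classical_sets reals.

Set Implicit Arguments.
Unset Strict Implicit.
Unset Printing Implicit Defensive.

Import Order.TTheory GRing.Theory Num.Theory.

Local Open Scope classical_set_scope.
Local Open Scope ring_scope.

(* A_I; the submatrix A^I of the complementary columns is [subcols A (~: I)]. *)
Definition subcols (T : Type) (d m : nat) (A : 'M[T]_(d, m))
    (I : {set 'I_m}) : 'M[T]_(d, #|I|) :=
  colsub (fun k : 'I_#|I| => enum_val k) A.

Definition cone (R : realType) (d m : nat) (A : 'M[R]_(d, m)) : set 'cV[R]_d :=
  [set x | exists2 c : 'cV[R]_m, (forall j, 0 <= c j 0) & x = A *m c].

Definition icone (R : realType) (d m : nat) (A : 'M[int]_(d, m)) :
    set 'cV[R]_d :=
  cone (map_mx intr A).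
Arguments icone R {d m} A.

Definition simplicial (R : realType) (d : nat) (C : set 'cV[R]_d) : Prop :=
  exists (k : nat) (B : 'M[R]_(d, k)), \rank B = k /\ C = cone B.

Definition is_linear_span (R : realType) (d : nat) (C : set 'cV[R]_d)
    (U : {vspace 'cV[R]_d}) : Prop :=
  (forall x, C x -> x \in U) /\
  (forall W : {vspace 'cV[R]_d}, (forall x, C x -> x \in W) -> (U <= W)%VS).

Definition has_dim (R : realType) (d : nat) (C : set 'cV[R]_d) (k : nat) :
    Prop :=
  exists2 U, is_linear_span C U & \dim U = k.

(* For C containing 0 (e.g. a cone) the affine hull is the linear span. *)
Definition relint (R : realType) (d : nat) (C : set 'cV[R]_d) : set 'cV[R]_d :=
  [set x | C x /\ exists U, is_linear_span C U /\
     exists2 e : R, 0 < e & forall y, y \in U ->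
       (forall i, `|y i 0 - x i 0| < e) -> C y].

Definition hyperplane (R : realType) (d : nat) (u : 'rV[R]_d) :
    set 'cV[R]_d :=
  [set x | (u *m x) 0 0 = 0].

Definition nonneg_on (R : realType) (d : nat) (u : 'rV[R]_d)
    (C : set 'cV[R]_d) : Prop :=
  forall x, C x -> 0 <= (u *m x) 0 0.

(* u = 0 is allowed, so that C is a face of itself. *)
Definition is_face (R : realType) (d : nat) (F C : set 'cV[R]_d) : Prop :=
  exists2 u : 'rV[R]_d, nonneg_on u C & F = C `&` hyperplane u.

Definition F_matrix (R : realType) (n r : nat) (V : 'M[int]_(n, n + r)) :
    Prop :=
  [/\ \rank (map_mx intr V : 'M[R]_(n, n + r)) = n,
      icone R V = setT,
      forall j, col j V != 0
    & forall i j, i != j -> ~ exists2 a : R, 0 < a &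
        map_mx intr (col i V) = a *: map_mx intr (col j V)].
Arguments F_matrix R {n r} V.

Definition reduced (d m : nat) (V : 'M[int]_(d, m)) : Prop :=
  forall j, (\big[gcdn/0%N]_(i < d) `|V i j|%N)%N = 1%N.

Definition row_echelon (d m : nat) (Q : 'M[int]_(d, m)) : Prop :=
  forall (i i' : 'I_d) (j' : 'I_m), (i < i')%N -> Q i' j' != 0 ->
    exists2 j : 'I_m, (j < j')%N & Q i j != 0.

(* The rows of Q form a Z-basis of ker V, and Q is normalised to be nonnegative
   and in row echelon form.  A nonnegative echelon form exists in general only
   after reordering the columns (its first column must lie on an extremal ray
   of the cone of Q), hence the permutation s. *)
Definition gale_dual (n r : nat) (V : 'M[int]_(n, n + r))
    (Q : 'M[int]_(r, n + r)) : Prop :=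
  [/\ forall x : 'rV[int]_(n + r),
        V *m x^T = 0 <-> exists c : 'rV[int]_r, x = c *m Q,
      forall c : 'rV[int]_r, c *m Q = 0 -> c = 0,
      forall i j, 0 <= Q i j
    & exists s : 'S_(n + r), row_echelon (col_perm s Q)].

Definition simplicial_intersection (R : realType) (r m : nat)
    (Q : 'M[int]_(r, m)) (C : set 'cV[R]_r) : Prop :=
  exists F : {set {set 'I_m}},
    [/\ F != finset.set0,
        forall J, J \in F -> simplicial (icone R (subcols Q J))
      & C = \bigcap_(J in [set` F]) icone R (subcols Q J)].

Definition chamber (R : realType) (r m : nat) (Q : 'M[int]_(r, m))
    (C : set 'cV[R]_r) : Prop :=
  [/\ simplicial_intersection Q C, has_dim C r
    & forall C', simplicial_intersection Q C' -> has_dim C' r ->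
        C' `<=` C -> C' = C].

Definition mov (R : realType) (r m : nat) (Q : 'M[int]_(r, m)) :
    set 'cV[R]_r :=
  \bigcap_(i in [set: 'I_m]) icone R (subcols Q (~: [set i]%SET)).
Arguments mov R {r m} Q.

(* A hyperplane supporting a cone passes through the origin.  For r = 1 the
   condition holds with hyperplane {0}. *)
Definition maxbord (R : realType) (r m : nat) (Q : 'M[int]_(r, m))
    (C : set 'cV[R]_r) : Prop :=
  exists u : 'rV[R]_r,
    [/\ u != 0, nonneg_on u (icone R Q),
        has_dim (hyperplane u `&` icone R Q) r.-1
      & has_dim (C `&` hyperplane u) r.-1].

Definition nonsingular_cols (r m : nat) (Q : 'M[int]_(r, m))
    (J : {set 'I_m}) : Prop :=
  exists e : #|J| = r, \det (castmx (erefl r, e) (subcols Q J)) != 0.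

Definition fan (R : realType) (n r : nat) (V : 'M[int]_(n, n + r))
    (Q : 'M[int]_(r, n + r)) (gamma : set 'cV[R]_r) : set (set 'cV[R]_n) :=
  [set sigma | exists J : {set 'I_(n + r)},
     [/\ nonsingular_cols Q J, gamma `<=` icone R (subcols Q J)
       & is_face sigma (icone R (subcols V (~: J)))]].

Definition ray (R : realType) (d m : nat) (V : 'M[int]_(d, m)) (j : 'I_m) :
    set 'cV[R]_d :=
  icone R (col j V).
Arguments ray R {d m} V j.

(* sigma(1), as a set of column indices *)
Definition rays_of (R : realType) (d m : nat) (V : 'M[int]_(d, m))
    (sigma : set 'cV[R]_d) : {set 'I_m} :=
  [set j | `[< is_face (ray R V j) sigma >]]%SET.

(* Sets of rays are encoded by the indices of the columns generating them
   (distinct columns of an F-matrix generate distinct rays). *)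
Definition in_one_cone (R : realType) (d m : nat) (V : 'M[int]_(d, m))
    (Sigma : set (set 'cV[R]_d)) (P : {set 'I_m}) : Prop :=
  exists2 sigma, Sigma sigma & forall j, j \in P -> ray R V j `<=` sigma.

Definition primitive_collection (R : realType) (d m : nat)
    (V : 'M[int]_(d, m)) (Sigma : set (set 'cV[R]_d)) (P : {set 'I_m}) : Prop :=
  ~ in_one_cone V Sigma P /\
  forall P' : {set 'I_m}, P' \proper P -> in_one_cone V Sigma P'.

(* a j is the total coefficient of the j-th column in the relation of P. *)
Definition primitive_relation (R : realType) (d m : nat)
    (V : 'M[int]_(d, m)) (Sigma : set (set 'cV[R]_d)) (P : {set 'I_m})
    (a : 'I_m -> rat) : Prop :=
  let v j : 'cV[R]_d := map_mx intr (col j V) in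
  exists (sigma : set 'cV[R]_d) (c : 'I_m -> rat),
    [/\ Sigma sigma,
        relint sigma (\sum_(j in P) v j),
        forall j, j \in rays_of V sigma -> 0 < c j,
        \sum_(j in P) v j - \sum_(j in rays_of V sigma) ratr (c j) *: v j = 0
      & forall j, a j = (if j \in P then 1 else 0) -
                        (if j \in rays_of V sigma then c j else 0)].

Definition nef_collection (R : realType) (d m : nat) (V : 'M[int]_(d, m))
    (Sigma : set (set 'cV[R]_d)) (P : {set 'I_m}) : Prop :=
  exists2 a : 'I_m -> rat, primitive_relation V Sigma P a & forall j, 0 <= a j.

(* Main.v *)
Require Import Defs.
From mathcomp Require Import all_boot all_order all_algebra all_fingroup.
From mathcomp Require Import boolp classical_sets reals.
From mathcomp Require Import ring lra.

(* Let q_j be the columns of Q and let u >= 0 on them cut out the common facet of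
   the cone of Q and gamma.  If x in gamma has positive coordinates on a basis of
   columns, then gamma lies in the cone of this basis, by minimality.  Applied to
   points near a generic point of the facet of gamma, this splits the columns
   into r classes -- those off the facet and, as r <= 3 makes the facet a cone
   over a point or a segment, those on either side of the generic point -- such
   that gamma lies in the cone of the q_j with j in K if and only if K meets every
   class.  By Gale duality the primitive collections are the classes, and the
   relation with coefficients u(q_j), rational up to scaling and supported on the
   class off the facet, shows that this class is nef. *)

Set Implicit Arguments.
Unset Strict Implicit.
Unset Printing Implicit Defensive.

Import Order.TTheory GRing.Theory Num.Theory.

Local Open Scope classical_set_scope.
Local Open Scope ring_scope.

(** * Cones over sets of columns *)

Section Cones.
Variable R : realType.

(** The consequences drawn from [facet_classes] hold for every r >= 1; the bound on r serves only to
    produce the classes. A cross-section of the facet is then at most one-dimensional, and on a line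
    each side of a generic point has a closest column, which lies in the cone of every choice of one
    column per side. Cross-sections make sense because the columns of V generate the whole space:
    this yields a functional g that is positive on all q_j. Simpliciality comes from the same
    closest columns. Over all columns p off the facet, the cones of p with the closest columns bound
    gamma by u >= 0 and, for each further class, by the strongest of finitely many inequalities.
    These are r independent linear forms, so gamma is generated by the dual basis. *)

Definition scone (d m : nat) (A : 'M[R]_(d, m)) (J : {set 'I_m}) :
    set 'cV[R]_d :=
  [set x | exists c : 'cV[R]_m,
     [/\ forall j, 0 <= c j 0, forall j, j \notin J -> c j 0 = 0
       & x = A *m c]].

Lemma pairing_mulE (d m : nat) (A : 'M[R]_(d, m)) (f : 'rV[R]_d)
    (c : 'cV[R]_m) :
  (f *m (A *m c)) 0 0 = \sum_j (f *m A) 0 j * c j 0.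
Proof. by rewrite mulmxA mxE. Qed.

Lemma pairingDr (d : nat) (f : 'rV[R]_d) (x y : 'cV[R]_d) :
  (f *m (x + y)) 0 0 = (f *m x) 0 0 + (f *m y) 0 0.
Proof. by rewrite mulmxDr mxE. Qed.

Lemma pairingZr (d : nat) (f : 'rV[R]_d) (a : R) (x : 'cV[R]_d) :
  (f *m (a *: x)) 0 0 = a * (f *m x) 0 0.
Proof. by rewrite -scalemxAr mxE. Qed.

Lemma pairingBr (d : nat) (f : 'rV[R]_d) (x y : 'cV[R]_d) :
  (f *m (x - y)) 0 0 = (f *m x) 0 0 - (f *m y) 0 0.
Proof. by rewrite -scaleN1r pairingDr pairingZr mulN1r. Qed.

Lemma pairing_colE (d m : nat) (A : 'M[R]_(d, m)) (f : 'rV[R]_d) (j : 'I_m) :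
  (f *m col j A) 0 0 = (f *m A) 0 j.
Proof. by rewrite colE mulmxA -colE mxE. Qed.

Lemma sconeD (d m : nat) (A : 'M[R]_(d, m)) (J : {set 'I_m}) x y :
  scone A J x -> scone A J y -> scone A J (x + y).
Proof.
move=> [c [c0 cJ ->]] [e [e0 eJ ->]]; exists (c + e).
split=> [j|j jJ|]; rewrite ?mulmxDr // mxE; first exact: addr_ge0.
by rewrite cJ // eJ // addr0.
Qed.

Lemma sconeZ (d m : nat) (A : 'M[R]_(d, m)) (J : {set 'I_m}) a x :
  0 <= a -> scone A J x -> scone A J (a *: x).
Proof.
move=> a0 [c [c0 cJ ->]]; exists (a *: c).
split=> [j|j jJ|]; rewrite ?scalemxAr // mxE; first exact: mulr_ge0.
by rewrite cJ // mulr0.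
Qed.

Lemma scone_col (d m : nat) (A : 'M[R]_(d, m)) (J : {set 'I_m}) j :
  j \in J -> scone A J (col j A).
Proof.
move=> jJ; exists (delta_mx j 0); split=> [i|i iJ|]; last exact: colE.
  by rewrite mxE; case: (_ && _).
by rewrite mxE; case: eqP => // ij; rewrite ij jJ in iJ.
Qed.

Lemma scone_sub (d m : nat) (A : 'M[R]_(d, m)) (J J' : {set 'I_m}) :
  J \subset J' -> scone A J `<=` scone A J'.
Proof.
move=> /fintype.subsetP sJ x [c [c0 cJ ->]]; exists c; split=> // j jJ'.
by apply: cJ; apply: contra jJ'; apply: sJ.
Qed.

Lemma scone_setT (d m : nat) (A : 'M[R]_(d, m)) :
  scone A [set: 'I_m]%SET = cone A.
Proof.
apply/seteqP; split=> x [c]; first by case=> c0 _ ->; exists c.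
by move=> c0 ->; exists c; split=> // j; rewrite inE.
Qed.

Lemma colsub_mulE (d m k : nat) (A : 'M[R]_(d, m)) (K : 'I_k -> 'I_m)
    (c : 'cV[R]_k) :
  colsub K A *m c = A *m \col_j \sum_(i | K i == j) c i 0.
Proof.
rewrite -[A in LHS]mulmx1 -mulmx_colsub -mulmxA; congr (_ *m _).
apply/matrixP=> j z; rewrite ord1 !mxE [RHS]big_mkcond; apply: eq_bigr => i _.
by rewrite !mxE eq_sym; case: (_ == _); rewrite ?mul1r ?mul0r.
Qed.

Lemma mul_colsubE (d m k : nat) (A : 'M[R]_(d, m)) (K : 'I_k -> 'I_m)
    (c : 'cV[R]_m) : injective K ->
  (forall j, j \notin [set K i | i in 'I_k]%SET -> c j 0 = 0) ->
  A *m c = colsub K A *m rowsub K c.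
Proof.
move=> Kinj cK; apply/matrixP=> a z; rewrite ord1 !mxE.
rewrite (bigID (mem [set K i | i in 'I_k]%SET)) /= [X in _ + X]big1 ?addr0.
  rewrite big_imset //=; last by move=> i i' _ _; apply: Kinj.
  by apply: eq_bigr => i _; rewrite !mxE.
by move=> j /cK ->; rewrite mulr0.
Qed.

Lemma cone_colsub (d m k : nat) (A : 'M[R]_(d, m)) (K : 'I_k -> 'I_m) :
  injective K -> cone (colsub K A) = scone A [set K i | i in 'I_k]%SET.
Proof.
move=> Kinj; apply/seteqP; split=> x.
  move=> [c c0 ->]; rewrite colsub_mulE; eexists; split; last by [].
    by move=> j; rewrite mxE; apply: sumr_ge0.
  move=> j jK; rewrite mxE big1 // => i /eqP Kij.
  by rewrite -Kij imset_f in jK.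
move=> [c [c0 cK ->]]; exists (rowsub K c); first by move=> i; rewrite mxE.
exact: mul_colsubE.
Qed.

(** Coefficients indexed by all columns and supported in [J] allow cones of different [J] to be
    compared without reindexing. *)
Lemma icone_subcols (d m : nat) (Q : 'M[int]_(d, m)) (J : {set 'I_m}) :
  icone R (subcols Q J) = scone (map_mx intr Q) J.
Proof.
rewrite /icone /subcols map_mxsub cone_colsub; last exact: enum_val_inj.
congr scone; apply/finset.setP=> j; apply/imsetP/idP => [[i _ ->]|jJ].
  exact: enum_valP.
by exists (enum_rank_in jJ j); rewrite // enum_rankK_in.
Qed.

Lemma cone_unit (d : nat) (B : 'M[R]_d) (x : 'cV[R]_d) : B \in unitmx ->
  cone B x <-> forall i, 0 <= (invmx B *m x) i 0.
Proof.
move=> Bu; split=> [[c c0 ->]|x0]; first by rewrite mulKmx.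
by exists (invmx B *m x); rewrite ?mulKVmx.
Qed.

Lemma unitmx_inj (d : nat) (B : 'M[R]_d) :
  (forall c : 'cV[R]_d, B *m c = 0 -> c = 0) -> B \in unitmx.
Proof.
move=> Binj; rewrite -unitmx_tr -row_free_unit; apply: inj_row_free => v vB.
by apply: trmx_inj; rewrite trmx0; apply: Binj; rewrite -[B]trmxK -trmx_mul vB trmx0.
Qed.

End Cones.

(** * Linear spans and dimension *)

Section Dimension.
Variables (R : realType) (d : nat).
Implicit Types (C : set 'cV[R]_d) (f u : 'rV[R]_d).

Definition annihilator f : {vspace 'cV[R]_d} :=
  lker (linfun (mulmx f : 'cV[R]_d -> 'M[R]_1)).

Lemma mem_annihilator f x : (x \in annihilator f) = ((f *m x) 0 0 == 0).
Proof.
rewrite memv_ker lfunE /=; apply/eqP/eqP => [-> | fx0]; first by rewrite mxE.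
by apply/matrixP=> i j; rewrite !ord1 fx0 mxE.
Qed.

Lemma dim_annihilator u : u != 0 -> \dim (annihilator u) = d.-1.
Proof.
move=> u0; set f := linfun (mulmx u : 'cV[R]_d -> 'M[R]_1).
have : (\dim (lker f) + \dim (limg f) = d * 1)%N.
  by have := limg_ker_dim f fullv; rewrite capfv dimvf dim_matrix.
rewrite muln1.
suff -> : \dim (limg f) = 1%N by rewrite addn1 => /(congr1 predn).
apply/eqP; rewrite eqn_leq; apply/andP; split.
  by rewrite (leq_trans (dimvS (subvf _))) // dimvf dim_matrix.
rewrite lt0n dimv_eq0; apply: contra u0 => /eqP f0.
apply/eqP/matrixP=> i j; rewrite ord1 [RHS]mxE.
have: f (delta_mx j 0) \in limg f by rewrite memv_img ?memvf.
rewrite f0 memv0 lfunE /= -colE => /eqP /matrixP /(_ 0 0).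
by rewrite !mxE.
Qed.

Lemma vanishing_full C f : has_dim C d ->
  (forall x, C x -> (f *m x) 0 0 = 0) -> f = 0.
Proof.
move=> [U [_ Umin] dU] fC; apply/eqP; apply/negPn/negP => f0.
have /dimvS : (U <= annihilator f)%VS.
  by apply: Umin => x Cx; rewrite mem_annihilator fC.
(* For [d = 0] the predecessor gives no contradiction, but then [f] has no entries and is zero. *)
have := dim_annihilator f0; rewrite dU => ->; case: d f f0 {fC} => [|n f _] //=.
  by move=> f /eqP[]; apply/matrixP=> i [].
by rewrite ltnn.
Qed.

Lemma span_annihilator C u : u != 0 -> has_dim (C `&` hyperplane u) d.-1 ->
  is_linear_span (C `&` hyperplane u) (annihilator u).
Proof.
move=> u0 [U [CU Umin] dU].
have Uu : (U <= annihilator u)%VS.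
  by apply: Umin => x [_ /= ux]; rewrite mem_annihilator ux.
suff <- : U = annihilator u by split.
by apply/eqP; rewrite eqEdim Uu dU dim_annihilator /=.
Qed.

(** A free family of points of [C] shorter than [\dim U] can be extended inside [C]: otherwise its
    span would contain [C], against the minimality of [U]. *)
Lemma is_linear_span_basis C U : is_linear_span C U ->
  exists2 X : seq 'cV[R]_d, basis_of U X & forall x, x \in X -> C x.
Proof.
move=> [CU Umin].
have: forall k, (k <= \dim U)%N ->
    exists X : seq 'cV[R]_d, [/\ size X = k, free X & forall x, x \in X -> C x].
  elim=> [_|k IHk kU]; first by exists [::]; rewrite nil_free.
  have [X [sX fX CX]] := IHk (ltnW kU).
  have [y [Cy yX]] : exists y, C y /\ y \notin <<X>>%VS.
    apply: contrapT => noy; suff /dimvS : (U <= <<X>>)%VS.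
      by move: fX; rewrite /free sX => /eqP ->; rewrite leqNgt kU.
    apply: Umin => x Cx; apply/negPn/negP => xX; by apply: noy; exists x.
  exists (y :: X); rewrite /= sX free_cons yX fX; split=> // x.
  by rewrite inE => /predU1P[->|/CX].
move=> /(_ _ (leqnn _)) [X [sX fX CX]]; exists X => //.
by rewrite basisEfree fX sX leqnn andbT /=; apply/span_subvP => x /CX /CU.
Qed.

End Dimension.

(** * Chambers and their minimality *)

Section Chambers.
Variables (R : realType) (r m : nat) (Q : 'M[int]_(r, m)).
Variable gamma : set 'cV[R]_r.
Hypothesis gammaP : chamber Q gamma.
Let A : 'M[R]_(r, m) := map_mx intr Q.

(** With [S] the sum of the [|b i| / a i], the step [1 / (1 + S)] is small enough for all indices at
    once. *)
Lemma small_shift (I : finType) (a b : I -> R) : (forall i, 0 < a i) ->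
  exists2 e : R, 0 < e & forall i, 0 < a i + e * b i.
Proof.
move=> a0; have [S S0 ltS] :
    exists2 S : R, 0 <= S & forall i, `|b i| / a i < 1 + S.
  exists (\sum_i `|b i| / a i) => [|i].
    by apply: sumr_ge0 => i _; rewrite divr_ge0 // ltW.
  rewrite (bigD1 i) //= addrCA ltrDl ltr_wpDr //.
  by apply: sumr_ge0 => k _; rewrite divr_ge0 // ltW.
have S1 : 0 < 1 + S by lra.
exists (1 + S)^-1 => [|i]; first by rewrite invr_gt0.
have := ltS i; rewrite ltr_pdivrMr // => {}ltS.
have : - `|b i| <= b i by rewrite lerNl -normrN ler_norm.
rewrite -(pmulr_rgt0 _ S1) mulrDr mulrA divff ?mul1r; last by rewrite gt_eqF.
lra.
Qed.

Lemma chamber_scone : exists2 F : {set {set 'I_m}}, F != finset.set0 &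
  gamma = \bigcap_(J in [set` F]) scone A J.
Proof.
have [[F [F0 _ ->]] _ _] := gammaP; exists F => //.
by apply: eq_bigcapr => J _; rewrite icone_subcols.
Qed.

Lemma chamberD x y : gamma x -> gamma y -> gamma (x + y).
Proof.
have [F _ ->] := chamber_scone => xF yF J JF.
by apply: sconeD; [exact: xF | exact: yF].
Qed.

Lemma chamberZ a x : 0 <= a -> gamma x -> gamma (a *: x).
Proof.
by have [F _ ->] := chamber_scone => a0 xF J JF; apply: sconeZ => //; exact: xF.
Qed.

Lemma chamber_cone : gamma `<=` cone A.
Proof.
have [F /set0Pn[J JF] ->] := chamber_scone; rewrite -scone_setT => x /(_ J JF).
by apply: scone_sub; rewrite finset.subsetT.
Qed.

Lemma colsub_unit_inj (K : 'I_r -> 'I_m) : colsub K A \in unitmx -> injective K.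
Proof.
move=> Bu i j Kij; have : colsub K A *m (delta_mx i 0 : 'cV_r) =
    colsub K A *m (delta_mx j 0 : 'cV_r).
  by rewrite -!colE; apply/matrixP=> a b; rewrite !mxE Kij.
move/(congr1 (mulmx (invmx (colsub K A)))); rewrite !mulKmx //.
move/matrixP/(_ i 0); rewrite !mxE !eqxx /= andbT.
by case: eqP => // _ /eqP; rewrite oner_eq0.
Qed.

(* Otherwise cutting with the simplicial cone of K would give a strictly smaller
   full-dimensional intersection. *)
Lemma chamber_minimal (K : 'I_r -> 'I_m) x : colsub K A \in unitmx ->
  gamma x -> (forall i, 0 < (invmx (colsub K A) *m x) i 0) ->
  gamma `<=` cone (colsub K A).
Proof.
set B := colsub K A => Bu gx x0; have Kinj := colsub_unit_inj Bu.
have [[F [F0 Fs gF]] [U [gU Umin] dU] gmin] := gammaP.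
set J0 := [set K i | i in 'I_r]%SET.
have J0E : icone R (subcols Q J0) = cone B by rewrite icone_subcols -cone_colsub.
suff <- : gamma `&` cone B = gamma by move=> y [].
apply: gmin; last exact: subIsetl.
- exists (J0 |: F)%SET; split.
  + by apply/set0Pn; exists J0; rewrite !inE eqxx.
  + move=> J; rewrite !inE => /predU1P[->|/Fs //]; rewrite J0E.
    have : row_free B by rewrite row_free_unit.
    by move/eqP; exists r, B.
  + rewrite {1}gF; apply/seteqP; split=> y.
      by move=> [yF yB] J /=; rewrite !inE => /predU1P[->|/yF //]; rewrite J0E.
    move=> yF; split; last by rewrite -J0E; apply: yF; rewrite /= !inE eqxx.
    by move=> J JF; apply: yF; rewrite /= !inE [J \in F]JF orbT.
(* The smaller intersection still spans everything: it contains [x] and, for small [e], also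
   [x + e *: y], and these two span [y]. *)
- exists U => //; split=> [y [gy _]|W gW]; first exact: gU.
  apply: Umin => y gy.
  have [e e0 xy] := small_shift (fun i => (invmx B *m y) i 0) x0.
  have xyW : x + e *: y \in W.
    apply: gW; split; first exact/chamberD/chamberZ/gy/ltW.
    apply/cone_unit => // i; rewrite mulmxDr -scalemxAr mxE [X in _ + X]mxE.
    exact/ltW/xy.
  have xW : x \in W by apply: gW; split=> //; apply/cone_unit => // i; apply: ltW.
  have -> : y = e^-1 *: ((x + e *: y) - x).
    by rewrite addrC addKr scalerA mulVf ?scale1r // gt_eqF.
  by rewrite memvZ // memvB.
Qed.

End Chambers.

(** * Chambers described by the classes of a facet *)

Section FacetClasses.
Variables (R : realType) (s m : nat).
Implicit Types (u : 'rV[R]_s.+1) (k : 'I_s -> 'I_m).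

Lemma colsub_recl (d : nat) (A : 'M[R]_(d, m)) (K : 'I_s.+1 -> 'I_m)
    (c : 'cV[R]_s.+1) :
  colsub K A *m c = c 0 0 *: col (K 0) A +
    colsub (fun i => K (lift 0 i)) A *m \col_i c (lift 0 i) 0.
Proof.
apply/matrixP=> a z; rewrite ord1 !mxE big_ord_recl !mxE mulrC.
by congr (_ + _); apply: eq_bigr => i _; rewrite !mxE.
Qed.

Lemma pairing_colsub (d k : nat) (A : 'M[R]_(d, m)) (f : 'rV[R]_d)
    (K : 'I_k -> 'I_m) (c : 'cV[R]_k) :
  (f *m (colsub K A *m c)) 0 0 = \sum_i (f *m A) 0 (K i) * c i 0.
Proof.
by rewrite pairing_mulE mulmx_colsub; apply: eq_bigr => i _; rewrite mxE.
Qed.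

Definition facet_section (cl : 'I_m -> 'I_s.+1) k :=
  forall i, cl (k i) = lift 0 i.

(* The combinatorial shape of a facet of gamma on the facet u = 0 of the cone of
   A: the columns in that facet fall into the s nonzero
   classes, and the facet of gamma is
   generated by the columns k0, the innermost ones of each class. *)
Definition facet_classes (A : 'M[R]_(s.+1, m)) u (w : 'cV[R]_s.+1)
    (cl : 'I_m -> 'I_s.+1) k0 : Prop :=
  [/\ forall j, (cl j == 0) = ((u *m A) 0 j != 0),
      facet_section cl k0,
      forall k, facet_section cl k ->
        [/\ exists2 c : 'cV[R]_s, forall i, 0 < c i 0 & w = colsub k A *m c,
            forall c : 'cV[R]_s, colsub k A *m c = 0 -> c = 0
          & forall i, cone (colsub k A) (col (k0 i) A)]
    & forall b : 'cV[R]_m, (forall j, 0 <= b j 0) -> w = A *m b ->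
        forall i : 'I_s, exists2 j, b j 0 != 0 & cl j = lift 0 i].

Variables (Q : 'M[int]_(s.+1, m)) (gamma : set 'cV[R]_s.+1).
Hypothesis gammaP : chamber Q gamma.
Let A : 'M[R]_(s.+1, m) := map_mx intr Q.
Variables (u : 'rV[R]_s.+1) (w : 'cV[R]_s.+1).
Variables (cl : 'I_m -> 'I_s.+1) (k0 : 'I_s -> 'I_m).
Hypothesis u0 : u != 0.
Hypothesis uA : forall j, 0 <= (u *m A) 0 j.
Hypothesis gw : gamma w.
Hypothesis facetP : facet_classes A u w cl k0.

Lemma facet_class0 j : (cl j == 0) = (0 < (u *m A) 0 j).
Proof. by have [-> _ _ _] := facetP; rewrite lt0r uA andbT. Qed.

Lemma facet_class_lift j i : cl j = lift 0 i -> (u *m A) 0 j = 0.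
Proof.
have [cl0 _ _ _] := facetP => clj; apply/eqP; have := cl0 j.
by rewrite clj eq_sym (negbTE (neq_lift _ _)) => /esym/negbFE.
Qed.

Lemma pairing_chamber x : gamma x -> 0 <= (u *m x) 0 0.
Proof.
move=> /(chamber_cone gammaP) [c c0 ->]; rewrite pairing_mulE.
by apply: sumr_ge0 => j _; rewrite mulr_ge0.
Qed.

(** Otherwise [u] would vanish on a full-dimensional set. *)
Lemma chamber_off_facet : exists2 y, gamma y & 0 < (u *m y) 0 0.
Proof.
apply: contrapT => noy; case/eqP: u0; have [_ gd _] := gammaP.
apply: (vanishing_full gd) => x gx; apply/eqP; rewrite eq_le pairing_chamber //.
by rewrite andbT leNgt; apply/negP => ux; apply: noy; exists x.
Qed.

Section ClassSection.
Variable K : 'I_s.+1 -> 'I_m.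
Hypothesis clK : forall i, cl (K i) = i.
Let k (i : 'I_s) := K (lift 0 i).

Lemma facet_section_lift : facet_section cl k.
Proof. by move=> i; exact: clK. Qed.

Lemma pairing_section (c : 'cV[R]_s.+1) :
  (u *m (colsub K A *m c)) 0 0 = c 0 0 * (u *m A) 0 (K 0).
Proof.
rewrite pairing_colsub big_ord_recl big1 ?addr0 1?mulrC // => i _.
by rewrite (facet_class_lift (facet_section_lift i)) mul0r.
Qed.

Lemma section_gt0 : 0 < (u *m A) 0 (K 0).
Proof. by rewrite -facet_class0 clK. Qed.

(** Pairing with [u] isolates the coefficient of column 0; the remaining columns of the section are
    independent by [facet_classes]. *)
Lemma section_unit : colsub K A \in unitmx.
Proof.
apply: unitmx_inj => c Kc.
have c00 : c 0 0 = 0.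
  have := pairing_section c; rewrite Kc mulmx0 mxE => /esym/eqP.
  by rewrite mulf_eq0 (gt_eqF section_gt0) orbF => /eqP.
have [_ _ /(_ _ facet_section_lift)[_ kinj _] _] := facetP.
move: Kc; rewrite colsub_recl c00 scale0r add0r => /kinj /matrixP ck.
apply/matrixP=> i z; rewrite ord1 [RHS]mxE.
by case: (unliftP 0 i) => [i' ->|->//]; have := ck i' 0; rewrite !mxE.
Qed.

(* The point w has positive coordinates on all the columns of the section but
   the first, and moving off the facet makes the first one positive too. *)
Lemma section_chamber : gamma `<=` cone (colsub K A).
Proof.
have [_ _ /(_ _ facet_section_lift)[[c c0 wE] _ _] _] := facetP.
have [y gy uy] := chamber_off_facet; set B := colsub K A.
have Bu : B \in unitmx := section_unit.
have y0 : 0 < (invmx B *m y) 0 0.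
  have := pairing_section (invmx B *m y); rewrite mulKVmx // => uyE.
  by move: uy; rewrite uyE pmulr_lgt0 // section_gt0.
have [e e0 ce] := small_shift (fun i => (invmx B *m y) (lift 0 i) 0) c0.
(* [c'] is [c] with a zero in front, as [w] has no component on the column off the facet. *)
set c' : 'cV[R]_s.+1 := \col_i oapp (fun j => c j 0) 0 (unlift 0 i).
have wc : w = B *m c'.
  rewrite colsub_recl mxE unlift_none scale0r add0r wE; congr (_ *m _).
  by apply/matrixP=> i z; rewrite ord1 !mxE liftK.
apply: (chamber_minimal gammaP Bu (x := w + e *: y)) => [|i].
  by apply: (chamberD gammaP) => //; apply: (chamberZ gammaP) => //; exact: ltW.
rewrite mulmxDr -scalemxAr wc mulKmx // mxE [X in _ + X]mxE [X in X + _]mxE.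
case: (unliftP 0 i) => [i' ->|->]; last by rewrite add0r mulr_gt0.
exact: ce.
Qed.

End ClassSection.

(** A nonzero class is met because any nonnegative expression of [w] uses it; class 0 is met because
    a point of [gamma] off the facet needs a column with [u] positive. *)
Lemma chamber_meets (J : {set 'I_m}) : gamma `<=` scone A J ->
  forall i, exists2 j, j \in J & cl j = i.
Proof.
move=> gJ i; have memJ (c : 'cV[R]_m) j :
    (forall j, j \notin J -> c j 0 = 0) -> c j 0 != 0 -> j \in J.
  by move=> cJ; apply: contraNT => /cJ ->.
case: (unliftP 0 i) => [i' ->|->].
  have [_ _ _ wcl] := facetP; have [c [c0 cJ wE]] := gJ _ gw.
  by have [j cj clj] := wcl _ c0 wE i'; exists j; first exact: memJ cj.
have [y /gJ[c [c0 cJ ->]] uy] := chamber_off_facet.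
apply: contrapT => noj; move: uy; rewrite pairing_mulE big1 ?ltxx // => j _.
have [jJ|/cJ ->] := boolP (j \in J); last by rewrite mulr0.
suff -> : (u *m A) 0 j = 0 by rewrite mul0r.
apply/eqP; rewrite eq_le uA andbT leNgt -facet_class0.
by apply/negP => /eqP clj; apply: noj; exists j.
Qed.

Lemma cone_colsub_sub (k : nat) (K : 'I_k -> 'I_m) (J : {set 'I_m}) :
  (forall i, K i \in J) -> cone (colsub K A) `<=` scone A J.
Proof.
move=> KJ x [c c0 ->]; rewrite colsub_mulE; eexists; split; last by [].
  by move=> j; rewrite mxE; apply: sumr_ge0.
move=> j jJ; rewrite mxE big1 // => i /eqP Kij.
by rewrite -Kij KJ in jJ.
Qed.

Lemma chamber_sconeP (J : {set 'I_m}) :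
  gamma `<=` scone A J <-> forall i, exists2 j, j \in J & cl j = i.
Proof.
split=> [/chamber_meets //|/fin_all_exists2[K KJ clK]].
exact: subset_trans (section_chamber clK) (cone_colsub_sub KJ).
Qed.

(** The chamber is the set where [u x >= 0] and [lam i x >= a i * u x] for all [i], where [a i] is
    the largest slope [lam i / u] of a column off the facet. These forms are the rows of the
    invertible [M], so the chamber is the cone of the columns of its inverse. *)
Lemma chamber_simplicial : simplicial gamma.
Proof.
have [_ clk0 kP _] := facetP.
have [p1 _ clp1] : exists2 j, j \in [set: 'I_m]%SET & cl j = 0.
  by apply: chamber_meets; rewrite scone_setT; exact: chamber_cone.
(* [K0 p] is the section made of [p] and the innermost columns [k0]. *)
pose K0 p i := oapp k0 p (unlift 0 i).
have K00 p : K0 p 0 = p by rewrite /K0 unlift_none.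
have K0l p : colsub (fun i => K0 p (lift 0 i : 'I_s.+1)) A = colsub k0 A.
  by apply/matrixP=> a i; rewrite !mxE /K0 liftK.
have clK0 p : cl p = 0 -> forall i, cl (K0 p i) = i.
  by move=> clp i; rewrite /K0; case: (unliftP 0 i) => [i' ->|->] //=.
have K0E p (c : 'cV[R]_s.+1) : colsub (K0 p) A *m c =
    c 0 0 *: col p A + colsub k0 A *m \col_i c (lift 0 i) 0.
  by rewrite colsub_recl K00 K0l.
pose B1 := colsub (K0 p1) A; have B1u : B1 \in unitmx := section_unit (clK0 _ clp1).
(* The coordinate along [k0 i] in the basis given by [p1] and [k0]; with [u] these forms separate
   points. *)
pose lam i (x : 'cV[R]_s.+1) := (invmx B1 *m x) (lift 0 i) 0.
have lamD i x y : lam i (x + y) = lam i x + lam i y.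
  by rewrite /lam mulmxDr mxE.
have lamZ i a x : lam i (a *: x) = a * lam i x.
  by rewrite /lam -scalemxAr mxE.
have lamk0 i (c : 'cV[R]_s) : lam i (colsub k0 A *m c) = c i 0.
  pose c' : 'cV[R]_s.+1 := \col_i oapp (fun j => c j 0) 0 (unlift 0 i).
  have -> : colsub k0 A *m c = B1 *m c'.
    rewrite K0E mxE unlift_none scale0r add0r; congr (_ *m _).
    by apply/matrixP=> a z; rewrite ord1 !mxE liftK.
  by rewrite /lam mulKmx // mxE liftK.
have uk0 (c : 'cV[R]_s) : (u *m (colsub k0 A *m c)) 0 0 = 0.
  by rewrite pairing_colsub big1 // => i _; rewrite (facet_class_lift (clk0 i)) mul0r.
have coord0 z : (u *m z) 0 0 = 0 -> (forall i, lam i z = 0) -> z = 0.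
  move=> uz lz; have := mulKVmx B1u z; rewrite K0E.
  have -> : \col_i (invmx B1 *m z) (lift 0 i) 0 = 0.
    by apply/matrixP=> i j; rewrite mxE [RHS]mxE; exact: lz.
  rewrite mulmx0 addr0; set a := (_ *m z) 0 0 => zE.
  move: uz; rewrite -zE pairingZr pairing_colE => /eqP.
  rewrite mulf_eq0 => /orP[/eqP ->|]; first by rewrite scale0r.
  by rewrite gt_eqF // -facet_class0 clp1.
have upos p : cl p = 0 -> 0 < (u *m A) 0 p by rewrite -facet_class0 => ->.
have /fin_all_exists[pm pmP] : forall i : 'I_s, exists p, cl p = 0 /\
    forall p', cl p' = 0 -> lam i (col p' A) / (u *m A) 0 p' <=
                            lam i (col p A) / (u *m A) 0 p.
  move=> i; have p1P : cl p1 == 0 by apply/eqP.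
  have [p /eqP clp pmax] := Order.TotalTheory.arg_maxP
    (P := fun p => cl p == 0) (fun p => lam i (col p A) / (u *m A) 0 p) p1P.
  by exists p; split=> // p' /eqP; apply: pmax.
pose a i := lam i (col (pm i) A) / (u *m A) 0 (pm i).
pose M : 'M[R]_s.+1 := \matrix_(i, j)
  if unlift 0 i is Some i' then invmx B1 (lift 0 i') j - a i' * u 0 j else u 0 j.
have M0 x : (M *m x) 0 0 = (u *m x) 0 0.
  by rewrite !mxE; apply: eq_bigr => j _; rewrite !mxE unlift_none.
have Ml x i : (M *m x) (lift 0 i) 0 = lam i x - a i * (u *m x) 0 0.
  rewrite /lam !mxE mulr_sumr -sumrB; apply: eq_bigr => j _.
  by rewrite !mxE liftK mulrBl mulrA.
have Mu : M \in unitmx.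
  apply: unitmx_inj => x Mx; have ux : (u *m x) 0 0 = 0 by rewrite -M0 Mx mxE.
  by apply: coord0 => // i; have := Ml x i; rewrite ux mulr0 subr0 Mx mxE.
exists s.+1, (invmx M); split.
  by apply/eqP; have : row_free (invmx M) by rewrite row_free_unit unitmx_inv.
apply/seteqP; split=> x.
  move=> gx; apply/cone_unit; rewrite ?unitmx_inv // invmxK => i.
  case: (unliftP 0 i) => [i' ->|->]; last by rewrite M0 pairing_chamber.
  rewrite Ml /a; have [clp _] := pmP i'; set p := pm i' in clp *.
  (* In the basis of [K0 p], with [p] of maximal slope, [lam i' x - a i' * u x] is just the
     coordinate of [x] along [k0 i']. *)
  have [c c0 ->] := section_chamber (clK0 _ clp) gx.
  rewrite pairing_section ?K00; last exact: clK0.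
  rewrite K0E lamD lamZ lamk0 mxE.
  rewrite -[X in _ - X]mulrA [_^-1 * _]mulrCA mulVf; last by rewrite gt_eqF ?upos.
  by rewrite mulr1 mulrC addrAC subrr add0r.
move/cone_unit; rewrite unitmx_inv invmxK => /(_ Mu) Mx.
have ux : 0 <= (u *m x) 0 0 by rewrite -M0.
(* Conversely, every [J] defining the chamber contains some [p] off the facet and a whole section,
   whose cone contains the columns [k0]; so it is enough to write [x] nonnegatively on [p] and
   [k0]. *)
have [F _ gF] := chamber_scone gammaP; rewrite gF => J JF.
have gJ : gamma `<=` scone A J by rewrite gF => z; apply.
have [p pJ clp] := chamber_meets gJ 0.
have /fin_all_exists2[k kJ clk] := fun i => chamber_meets gJ (lift 0 i).
have k0J i : scone A J (col (k0 i) A).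
  by have [_ _ /(_ i)] := kP _ clk; exact: cone_colsub_sub.
pose c := (u *m x) 0 0 / (u *m A) 0 p.
have c0 : 0 <= c by rewrite divr_ge0 // ltW ?upos.
pose e : 'cV[R]_s := \col_i (lam i x - c * lam i (col p A)).
have e0 i : 0 <= e i 0.
  have := Mx (lift 0 i); rewrite Ml => le_a.
  have [_ /(_ _ clp) pmax] := pmP i; apply: le_trans le_a _.
  rewrite [e i 0]mxE lerD2l lerN2 /c mulrAC -mulrA mulrC.
  exact: ler_wpM2r.
have -> : x = c *: col p A + colsub k0 A *m e.
  apply/eqP; rewrite -subr_eq0; apply/eqP; apply: coord0 => [|i].
    rewrite pairingDr -scaleN1r pairingZr pairingDr pairingZr pairing_colE uk0.
    by rewrite divfK ?gt_eqF ?upos // addr0 mulN1r subrr.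
  rewrite lamD -scaleN1r lamZ lamD lamZ lamk0 mxE; ring.
apply: sconeD; first by apply: sconeZ => //; apply: scone_col.
have -> : colsub k0 A *m e = \sum_i e i 0 *: col (k0 i) A.
  apply/matrixP=> i z; rewrite ord1 mxE summxE.
  by apply: eq_bigr => j _; rewrite !mxE mulrC.
elim/big_ind: _ => [|y z|i _]; [|exact: sconeD|exact: sconeZ].
by exists 0; split=> [j|j _|]; rewrite ?mulmx0 ?mxE.
Qed.

End FacetClasses.

(** * Existence of the classes for r at most 3 *)

Section FacetClassesExist.
Variables (R : realType) (s m : nat) (Q : 'M[int]_(s.+1, m)).
Variable gamma : set 'cV[R]_s.+1.
Hypothesis gammaP : chamber Q gamma.
Let A : 'M[R]_(s.+1, m) := map_mx intr Q.
Variables g u : 'rV[R]_s.+1.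
Hypothesis gA : forall j, 0 < (g *m A) 0 j.
Hypothesis uA : forall j, 0 <= (u *m A) 0 j.
Hypothesis u0 : u != 0.
Hypothesis facet_dim : has_dim (gamma `&` hyperplane u) s.

Lemma facet_basis : exists X : seq 'cV[R]_s.+1,
  [/\ size X = s, basis_of (annihilator u) X
    & forall x, x \in X -> gamma x /\ (u *m x) 0 0 = 0].
Proof.
have [X bX gX] := is_linear_span_basis (span_annihilator u0 facet_dim).
exists X; split; [|exact: bX|by move=> x /gX].
by have := basis_free bX; rewrite /free (span_basis bX) dim_annihilator // => /eqP.
Qed.

Lemma col_neq0 j : col j A != 0.
Proof.
apply/eqP => qj; have := gA j.
by rewrite -pairing_colE qj mulmx0 mxE ltxx.
Qed.

Lemma pairing_gt0 x : gamma x -> x != 0 -> 0 < (g *m x) 0 0.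
Proof.
move=> /(chamber_cone gammaP)[c c0 ->] x0; rewrite pairing_mulE.
rewrite lt0r sumr_ge0 ?andbT => [|j _]; last by rewrite mulr_ge0 // ltW.
apply: contra x0; rewrite psumr_eq0 => [/allP cA|j _]; last by rewrite mulr_ge0 // ltW.
rewrite (_ : c = 0) ?mulmx0 //; apply/matrixP=> j z; rewrite ord1 mxE.
have := cA j (mem_index_enum j); rewrite mulf_eq0 gt_eqF //= => /eqP //.
Qed.

(** The set [u = 0] cuts out a face: nonnegative terms with sum zero all vanish. *)
Lemma facet_support (b : 'cV[R]_m) : (forall j, 0 <= b j 0) ->
  (u *m (A *m b)) 0 0 = 0 -> forall j, b j 0 != 0 -> (u *m A) 0 j = 0.
Proof.
move=> b0; rewrite pairing_mulE => /eqP.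
rewrite psumr_eq0 => [/allP ub j bj|j _]; last by rewrite mulr_ge0.
have := ub j (mem_index_enum j).
by rewrite mulf_eq0 (negbTE bj) orbF => /eqP.
Qed.

End FacetClassesExist.

(** For r = 1 the facet is the origin, and a nonzero [u] vanishes on no column, so class 0 is
    everything. *)
Lemma facet_classes_point (R : realType) (m : nat) (Q : 'M[int]_(1, m))
    (gamma : set 'cV[R]_1) (g u : 'rV[R]_1) :
  chamber Q gamma -> (forall j, 0 < (g *m map_mx intr Q) 0 j) -> u != 0 ->
  exists (w : 'cV[R]_1) cl k0,
    gamma w /\ facet_classes (map_mx intr Q) u w cl k0.
Proof.
move=> gammaP gA u0; exists 0, (fun=> 0).
have k0 : 'I_0 -> 'I_m by case.
exists k0; split.
  have [F _ ->] := chamber_scone gammaP => J _.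
  by exists 0; split=> [j|j _|]; rewrite ?mulmx0 ?mxE.
split=> [j|[]//|k _|b _ _ []//]; last first.
  split=> [||[]//]; last by move=> c _; exact: flatmx0.
  by exists 0; [case | rewrite mulmx0].
rewrite eqxx; apply/esym; apply: contra (col_neq0 gA j) => /eqP uj.
have u00 : u 0 0 != 0.
  by apply: contra u0 => /eqP u00; apply/eqP/matrixP=> i z; rewrite !ord1 u00 mxE.
move: uj; rewrite mxE big_ord1 => /eqP; rewrite mulf_eq0 (negbTE u00) /= => /eqP.
by move=> Aj; apply/eqP/matrixP=> i z; rewrite !ord1 mxE Aj mxE.
Qed.

(** For r = 2 the facet is a ray: its columns are all positive multiples of [w], so any one of them
    can serve as [k0]. *)
Lemma facet_classes_ray (R : realType) (m : nat) (Q : 'M[int]_(2, m))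
    (gamma : set 'cV[R]_2) (g u : 'rV[R]_2) :
  chamber Q gamma -> (forall j, 0 < (g *m map_mx intr Q) 0 j) ->
  (forall j, 0 <= (u *m map_mx intr Q) 0 j) -> u != 0 ->
  has_dim (gamma `&` hyperplane u) 1 ->
  exists (w : 'cV[R]_2) cl k0,
    gamma w /\ facet_classes (map_mx intr Q) u w cl k0.
Proof.
set A := map_mx intr Q => gammaP gA uA u0 gd.
have [[|w [|? ?]] [//= _ bX gX]] := facet_basis u0 gd.
have [gw uw] : gamma w /\ (u *m w) 0 0 = 0 by apply: gX; rewrite inE.
have w0 : w != 0 by rewrite -seq1_free (basis_free bX).
have gw0 : 0 < (g *m w) 0 0 by apply: (pairing_gt0 gammaP gA).
have colE j : (u *m A) 0 j = 0 -> exists2 a, 0 < a & col j A = a *: w.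
  move=> uj; have : col j A \in annihilator u.
    by rewrite mem_annihilator pairing_colE uj.
  rewrite -(span_basis bX) span_seq1 => /vlineP[a qE]; exists a => //.
  by have := gA j; rewrite -pairing_colE qE pairingZr pmulr_lgt0.
pose cl j : 'I_2 := if (u *m A) 0 j == 0 then lift 0 (0 : 'I_1) else 0.
have clP (b : 'cV[R]_m) : (forall j, 0 <= b j 0) -> w = A *m b ->
    forall i : 'I_1, exists2 j, b j 0 != 0 & cl j = lift 0 i.
  move=> b0 wE i; have [j bj] : exists j, b j 0 != 0.
    apply: contrapT => nob; case/eqP: w0; rewrite wE (_ : b = 0) ?mulmx0 //.
    apply/matrixP=> j z; rewrite ord1 mxE; apply/eqP/negPn/negP => bj.
    by apply: nob; exists j.
  exists j => //; rewrite /cl (facet_support uA b0 _ bj) -?wE // eqxx.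
  by rewrite !ord1.
have [b b0 wE] := chamber_cone gammaP gw.
have [j0 _ clj0] := clP b b0 wE 0.
have clE k (i : 'I_1) : cl k = lift 0 i -> (u *m A) 0 k = 0.
  by rewrite /cl; case: ((u *m A) 0 k =P 0).
have colsub1 (k : 'I_1 -> 'I_m) (c : 'cV[R]_1) :
    colsub k A *m c = c 0 0 *: col (k 0) A.
  by apply/matrixP=> i z; rewrite !ord1 !mxE big_ord1 !mxE mulrC.
exists w, cl, (fun=> j0); split=> //; split=> // [j|i|k kP].
- by rewrite /cl; case: ifP => //; rewrite eqxx.
- by rewrite ord1.
have [a a0 kE] := colE _ (clE _ _ (kP 0)).
split.
- exists (const_mx a^-1) => [i|]; first by rewrite mxE invr_gt0.
  by rewrite colsub1 mxE kE scalerA mulVf ?scale1r // gt_eqF.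
- move=> c; rewrite colsub1 kE scalerA => /eqP.
  rewrite scaler_eq0 (negbTE w0) orbF mulf_eq0 (gt_eqF a0) orbF => /eqP c0.
  by apply/matrixP=> i z; rewrite !ord1 c0 mxE.
- move=> i; have [a' a'0 k0E] := colE _ (clE _ _ clj0).
  exists (const_mx (a' / a)) => [?|]; first by rewrite mxE divr_ge0 // ltW.
  by rewrite colsub1 mxE kE k0E scalerA divfK // gt_eqF.
Qed.

(** Pigeonhole: the numbers [1 / (k + 2)] provide one candidate more than [t] has indices. *)
Lemma avoid_finite (R : realType) (I : finType) (t : I -> R) :
  exists x, [/\ 0 < x, x < 1 & forall i, t i != x].
Proof.
apply: contrapT => nox; pose x (k : 'I_#|I|.+1) : R := k.+2%:R^-1.
have /fin_all_exists[f tf] : forall k, exists i, t i = x k.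
  move=> k; apply: contrapT => nok; apply: nox; exists (x k); split.
  - by rewrite invr_gt0.
  - by rewrite invf_lt1 // ltr1n.
  - by move=> i; apply/eqP => ti; apply: nok; exists i.
suff /leq_card : injective f by rewrite card_ord ltnn.
move=> k k' fk; have := tf k'; rewrite -fk tf => /invr_inj /eqP.
by rewrite eqr_nat => /eqP[] /ord_inj.
Qed.

Section Pencil.
Variables (R : realType) (m : nat) (Q : 'M[int]_(3, m)).
Variable gamma : set 'cV[R]_3.
Hypothesis gammaP : chamber Q gamma.
Let A : 'M[R]_(3, m) := map_mx intr Q.
Variables g u : 'rV[R]_3.
Hypothesis gA : forall j, 0 < (g *m A) 0 j.
Hypothesis uA : forall j, 0 <= (u *m A) 0 j.
Hypothesis u0 : u != 0.
Hypothesis facet_dim : has_dim (gamma `&` hyperplane u) 2.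

(* An affine coordinate t on the line g = 1 of the plane u = 0, centred at a
   point w of gamma which is on no ray of a column. *)
Lemma facet_pencil : exists (w d : 'cV[R]_3) (t : 'I_m -> R),
  [/\ gamma w /\ (u *m w) 0 0 = 0, (g *m w) 0 0 = 1,
      (g *m d) 0 0 = 0 /\ d != 0
    & forall j, (u *m A) 0 j = 0 ->
        t j != 0 /\ col j A = (g *m A) 0 j *: (w + t j *: d)].
Proof.
have [[|w1 [|w2 [|? ?]]] [//= _ bX gX]] := facet_basis u0 facet_dim.
have [gw1 uw1] : gamma w1 /\ (u *m w1) 0 0 = 0 by apply: gX; rewrite !inE eqxx.
have [gw2 uw2] : gamma w2 /\ (u *m w2) 0 0 = 0.
  by apply: gX; rewrite !inE eqxx orbT.
have := basis_free bX; rewrite free_cons span_seq1 seq1_free => /andP[w12 w2n0].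
have w1n0 : w1 != 0 by apply: contraNneq w12 => ->; rewrite mem0v.
have g1 : 0 < (g *m w1) 0 0 by apply: (pairing_gt0 gammaP gA).
have g2 : 0 < (g *m w2) 0 0 by apply: (pairing_gt0 gammaP gA).
have [v1 v1E] : exists v, v = ((g *m w1) 0 0)^-1 *: w1 by eexists.
have [v2 v2E] : exists v, v = ((g *m w2) 0 0)^-1 *: w2 by eexists.
have gv1 : (g *m v1) 0 0 = 1 by rewrite v1E pairingZr mulVf // gt_eqF.
have gv2 : (g *m v2) 0 0 = 1 by rewrite v2E pairingZr mulVf // gt_eqF.
have gd : (g *m (v2 - v1)) 0 0 = 0.
  by rewrite pairingBr gv1 gv2 subrr.
have dn0 : v2 - v1 != 0.
  apply: contra w12; rewrite subr_eq0 => /eqP v21.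
  have -> : w1 = (g *m w1) 0 0 *: v1 by rewrite v1E scalerA divff ?scale1r // gt_eqF.
  by rewrite -v21 v2E !memvZ // memv_line.
have /fin_all_exists[tau tauP] : forall j, exists t, (u *m A) 0 j = 0 ->
    col j A = (g *m A) 0 j *: (v1 + t *: (v2 - v1)).
  move=> j; have [uj|uj] := eqVneq ((u *m A) 0 j) 0; last first.
    by exists 0 => uj0; rewrite uj0 eqxx in uj.
  have : col j A \in annihilator u by rewrite mem_annihilator pairing_colE uj.
  rewrite -(span_basis bX) span_cons span_seq1.
  move=> /memv_addP[_ /vlineP[a ->] [_ /vlineP[b ->] qE]].
  have {}qE : col j A =
      (a * (g *m w1) 0 0) *: v1 + (b * (g *m w2) 0 0) *: v2.
    by rewrite v1E v2E !scalerA !mulfK ?gt_eqF.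
  move: (a * _) (b * _) qE => {}a {}b qE.
  have gE : (g *m A) 0 j = a + b.
    by rewrite -pairing_colE qE pairingDr !pairingZr gv1 gv2 !mulr1.
  have gj := gA j; exists (b / (g *m A) 0 j) => _.
  rewrite scalerDr scalerA [_ * (b / _)]mulrC divfK ?gt_eqF // gE qE.
  by rewrite scalerBr scalerDl -addrA; congr (_ + _); rewrite addrC subrK.
(* Taking [x] in the open unit interval keeps the new centre in [gamma]; avoiding the values of
   [tau] makes every shifted coordinate nonzero. *)
have [x [x0 x1 tx]] := avoid_finite tau.
exists (v1 + x *: (v2 - v1)), (v2 - v1), (fun j => tau j - x).
have wE : v1 + x *: (v2 - v1) = (1 - x) *: v1 + x *: v2.
  by rewrite scalerBr scalerBl scale1r addrA addrAC.
split=> [|||j uj].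
- rewrite wE v1E v2E; split.
    have gv (y : 'cV[R]_3) a b : 0 <= a -> 0 < b -> gamma y ->
        gamma (a *: (b^-1 *: y)).
      move=> a0 b0 gy; apply: (chamberZ gammaP) => //.
      by apply: (chamberZ gammaP) => //; rewrite invr_ge0 ltW.
    apply: (chamberD gammaP); apply: gv => //; [lra | exact: ltW].
  by rewrite pairingDr !pairingZr uw1 uw2; lra.
- by rewrite pairingDr pairingZr gd gv1; lra.
- by [].
- split; first by rewrite subr_eq0.
  by rewrite tauP // -addrA -scalerDl [x + _]addrC subrK.
Qed.

(** For r = 3 the two classes on the facet are the signs of [t]. A column of each sign encloses [w],
    and also encloses the columns [l] and [r] whose [t] is closest to zero. *)
Lemma facet_classes_pencil : exists (w : 'cV[R]_3) cl k0,
  gamma w /\ facet_classes A u w cl k0.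
Proof.
have [w [d [t [[gw uw] gw1 [gd dn0] tP]]]] := facet_pencil.
pose cl j : 'I_3 := if (u *m A) 0 j != 0 then 0
  else if 0 < t j then lift 0 (0 : 'I_2) else lift 0 (1 : 'I_2).
have cl1 j : cl j = lift 0 (0 : 'I_2) <-> (u *m A) 0 j = 0 /\ 0 < t j.
  rewrite /cl; case: ((u *m A) 0 j =P 0) => /= uj; last by split=> // -[].
  by case: ifP => tj; split=> // -[].
have cl2 j : cl j = lift 0 (1 : 'I_2) <-> (u *m A) 0 j = 0 /\ t j < 0.
  rewrite /cl; case: ((u *m A) 0 j =P 0) => /= uj; last by split=> // -[].
  have [tj0 _] := tP j uj; rewrite [t j < 0]lt_neqAle tj0 leNgt /=.
  by case: ifP => tj; split=> // -[].
(* The sign of [e] selects a side. Comparing [g] and the component along [d] shows that the weights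
   [B] sum to 1 and average [t] to 0, so [t] cannot keep one sign on the support of [b]. *)
have side (b : 'cV[R]_m) e : (forall j, 0 <= b j 0) -> w = A *m b -> e != 0 ->
    exists j, [/\ b j 0 != 0, (u *m A) 0 j = 0 & 0 < e * t j].
  move=> b0 wE en0; apply: contrapT => noj.
  have bsupp := facet_support uA b0; rewrite -wE uw in bsupp.
  pose B j := b j 0 * (g *m A) 0 j.
  have wB : w = (\sum_j B j) *: w + (\sum_j B j * t j) *: d.
    rewrite !scaler_suml -big_split {1}wE /=; apply/matrixP=> i z.
    rewrite ord1 mxE summxE; apply: eq_bigr => j _; rewrite [LHS]mulrC.
    have [bj|bj] := eqVneq (b j 0) 0; first by rewrite /B bj !mul0r !scale0r addr0 mxE.
    have [_ /matrixP/(_ i 0)] := tP j (bsupp erefl j bj).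
    by rewrite [col _ _ _ _]mxE => ->; rewrite /B !mxE; ring.
  have B1 : \sum_j B j = 1.
    by have := congr1 (fun x => (g *m x) 0 0) wB; rewrite pairingDr !pairingZr gd gw1; lra.
  move: wB; rewrite B1 scale1r -{1}[w]addr0 => /addrI/esym/eqP.
  rewrite scaler_eq0 (negbTE dn0) orbF => /eqP Bt.
  have : \sum_j - (e * (B j * t j)) == 0.
    by rewrite sumrN -mulr_sumr Bt mulr0 oppr0.
  rewrite psumr_eq0 => [/allP B0|j _].
    case/eqP: (oner_neq0 R); rewrite -B1 big1 // => j _.
    have [bj|bj] := eqVneq (b j 0) 0; first by rewrite /B bj mul0r.
    have [tj _] := tP j (bsupp erefl j bj).
    have := B0 j (mem_index_enum j).
    by rewrite oppr_eq0 !mulf_eq0 (negbTE en0) (negbTE tj) (negbTE bj) gt_eqF.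
  have [bj|bj] := eqVneq (b j 0) 0; first by rewrite /B bj !mul0r mulr0 oppr0.
  rewrite oppr_ge0 mulrCA pmulr_rle0; last by rewrite mulr_gt0 // lt0r bj b0.
  by rewrite leNgt; apply/negP => et; apply: noj; exists j; split=> //; exact: bsupp.
have clP (b : 'cV[R]_m) : (forall j, 0 <= b j 0) -> w = A *m b ->
    forall i : 'I_2, exists2 j, b j 0 != 0 & cl j = lift 0 i.
  move=> b0 wE i.
  have [|i1] := eqVneq i 0 => [->|].
    have [j [bj uj]] := side b 1 b0 wE (oner_neq0 _).
    by rewrite mul1r => tj; exists j => //; apply/cl1.
  have -> : i = 1 by apply/val_inj; case: i i1 => -[|[|]].
  have [|j [bj uj]] := side b (-1) b0 wE; first by rewrite oppr_eq0 oner_eq0.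
  by rewrite mulN1r oppr_gt0 => tj; exists j => //; apply/cl2.
have [b b0 wE] := chamber_cone gammaP gw.
have [l [ucl tl] lmin] : exists2 l, (u *m A) 0 l = 0 /\ 0 < t l &
    forall j, (u *m A) 0 j = 0 /\ 0 < t j -> t l <= t j.
  have [j0 _ /cl1 [/eqP uj0 tj0]] := clP b b0 wE 0.
  have j0P : ((u *m A) 0 j0 == 0) && (0 < t j0) by rewrite uj0.
  have [l /andP[/eqP ul tl] lmin] := Order.TotalTheory.arg_minP
    (P := fun j => ((u *m A) 0 j == 0) && (0 < t j)) t j0P.
  by exists l => // j [/eqP uj tj]; apply: lmin; rewrite uj.
have [r [ur tr] rmax] : exists2 r, (u *m A) 0 r = 0 /\ t r < 0 &
    forall j, (u *m A) 0 j = 0 /\ t j < 0 -> t j <= t r.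
  have [j0 _ /cl2 [/eqP uj0 tj0]] := clP b b0 wE 1.
  have j0P : ((u *m A) 0 j0 == 0) && (t j0 < 0) by rewrite uj0.
  have [r /andP[/eqP ur tr] rmax] := Order.TotalTheory.arg_maxP
    (P := fun j => ((u *m A) 0 j == 0) && (t j < 0)) t j0P.
  by exists r => // j [/eqP uj tj]; apply: rmax; rewrite uj.
pose k0 (i : 'I_2) := if i == 0 then l else r.
have colsub2 (k : 'I_2 -> 'I_m) (c : 'cV[R]_2) :
    colsub k A *m c = c 0 0 *: col (k 0) A + c 1 0 *: col (k 1) A.
  apply/matrixP=> i z; rewrite !ord1 !mxE big_ord_recl big_ord1 !mxE.
  by rewrite mulrC [X in _ + X]mulrC (_ : lift _ _ = 1) //; apply: val_inj.
exists w, cl, k0; split=> //; split=> // [j|i|k kP].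
- by rewrite /cl; case: ((u *m A) 0 j =P 0) => //= _; case: ifP.
- rewrite /k0; have [->|i1] := eqVneq i 0; first exact/cl1.
  have -> : i = 1 by apply/val_inj; case: i i1 => -[|[|]].
  exact/cl2.
have /cl1[uk0 tk0] := kP 0; have /cl2[uk1 tk1] := kP 1.
have [_ q0] := tP _ uk0; have [_ q1] := tP _ uk1.
move: (gA (k 0)) (gA (k 1)) q0 q1; set G0 := (g *m A) 0 (k 0).
set G1 := (g *m A) 0 (k 1); move: G0 G1 => G0 G1 G0p G1p q0 q1.
have G0n := lt0r_neq0 G0p; have G1n := lt0r_neq0 G1p.
have tt : 0 < t (k 0) - t (k 1) by lra.
have ttn := lt0r_neq0 tt.
(* Linear interpolation between the points with coordinates [t (k 1)] and [t (k 0)]; dividing by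
   [G0] and [G1] undoes the normalisation [g = 1]. *)
have between (x : R) : w + x *: d = colsub k A *m
    \col_(i < 2) (if i == 0 then (x - t (k 1)) / (t (k 0) - t (k 1)) / G0
                  else (t (k 0) - x) / (t (k 0) - t (k 1)) / G1).
  rewrite colsub2 q0 q1 !mxE /= !scalerA !divfK //.
  by apply/matrixP=> i z; rewrite !mxE; field.
have inside j : (u *m A) 0 j = 0 -> t (k 1) <= t j -> t j <= t (k 0) ->
    cone (colsub k A) (col j A).
  move=> uj tj1 tj0; have [_ ->] := tP j uj; rewrite between scalemxAr.
  eexists; last by [].
  move=> i; rewrite mxE [X in _ * X]mxE; apply: mulr_ge0; first exact/ltW/gA.
  by case: ifP => _; rewrite !divr_ge0 ?(ltW tt) ?(ltW G0p) ?(ltW G1p) ?subr_ge0.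
split.
- have := between 0; rewrite scale0r addr0.
  set c := \col_i _ => wc; exists c => // i; rewrite mxE.
  by case: ifP => _; rewrite !divr_gt0 //; lra.
- move=> c; rewrite colsub2 q0 q1 => cE.
  have := congr1 (fun x => (g *m x) 0 0) cE.
  rewrite mulmx0 !(pairingDr, pairingZr) gw1 gd mxE !mulr0 !addr0 !mulr1 => gc.
  (* The relation [gc] removes [w] and the second column, leaving a multiple of [d]. *)
  have /eqP : (c 0 0 * G0 * (t (k 0) - t (k 1))) *: d = 0.
    apply/matrixP=> i z; have := congr1 (fun x : 'cV[R]_3 => x i z) cE.
    rewrite !mxE => ce; transitivity
      (c 0 0 * (G0 * (w i z + t (k 0) * d i z)) +
       c 1 0 * (G1 * (w i z + t (k 1) * d i z)) -
       (c 0 0 * G0 + c 1 0 * G1) * (w i z + t (k 1) * d i z)); first by ring.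
    by rewrite ce gc mul0r subr0.
  rewrite scaler_eq0 (negbTE dn0) orbF !mulf_eq0 (negbTE G0n) (negbTE ttn) !orbF.
  move=> /eqP c0; move: gc; rewrite c0 mul0r add0r => /eqP.
  rewrite mulf_eq0 (negbTE G1n) orbF => /eqP c1.
  apply/matrixP=> i z; rewrite ord1 mxE.
  have [->|i1] := eqVneq i 0; first by [].
  by rewrite (_ : i = 1) //; apply/val_inj; case: i i1 => -[|[|]].
- move=> i; rewrite /k0; case: ifP => _; apply: inside => //.
  + by apply: ltW; lra.
  + exact: lmin.
  + exact: rmax.
  + by apply: ltW; lra.
Qed.

End Pencil.

(** * Independent columns: faces and relative interior *)

Section SimplicialCones.
Variables (R : realType) (d m : nat) (V : 'M[R]_(d, m)).
Implicit Types S T : {set 'I_m}.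

Definition supported S (b : 'cV[R]_m) := forall j, j \notin S -> b j 0 = 0.

Definition independent_cols S :=
  forall b, supported S b -> V *m b = 0 -> b = 0.

Lemma supported_sub S T b : S \subset T -> supported S b -> supported T b.
Proof.
by move=> /fintype.subsetP sST bS j jT; apply: bS; apply: contra jT; apply: sST.
Qed.

Lemma supported_mulmx (f : 'rV[R]_d) S b : supported S b ->
  (f *m (V *m b)) 0 0 = \sum_(j in S) (f *m V) 0 j * b j 0.
Proof.
move=> bS; rewrite pairing_mulE (bigID (mem S)) /= [X in _ + X]big1 ?addr0 //.
by move=> j jS; rewrite bS // mulr0.
Qed.

(** Coordinates become linear in the point, which supplies both the functional cutting out a face
    and the estimate for relative interiors. *)
Lemma independent_coords T : independent_cols T ->
  exists L : 'M[R]_(m, d), forall b, supported T b -> L *m (V *m b) = b.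
Proof.
move=> Tind; pose K : 'I_#|T| -> 'I_m := fun i => enum_val i.
have Kinj : injective K by exact: enum_val_inj.
have imK : [set K i | i in 'I_#|T|]%SET = T.
  apply/finset.setP=> j; apply/imsetP/idP => [[i _ ->]|jT]; first exact: enum_valP.
  by exists (enum_rank_in jT j); rewrite // /K enum_rankK_in.
have bK b : supported T b ->
    forall j, j \notin [set K i | i in 'I_#|T|]%SET -> b j 0 = 0.
  by rewrite imK.
have /row_freeP[D DE] : row_free (colsub K V)^T.
  apply: inj_row_free => v; move/(congr1 trmx); rewrite trmx_mul trmxK trmx0.
  rewrite colsub_mulE; set b := \col_j _ => Vb.
  have bT : supported T b.
    move=> j jT; rewrite mxE big1 // => i /eqP Kij.
    by rewrite -Kij enum_valP in jT.
  apply/matrixP=> z i; rewrite ord1 [RHS]mxE.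
  have := congr1 (fun b : 'cV[R]_m => b (K i) 0) (Tind b bT Vb).
  rewrite !mxE (big_pred1 i) ?mxE // => i'.
  by rewrite (inj_eq Kinj).
exists (colsub K 1%:M *m D^T) => b bT.
rewrite (mul_colsubE _ Kinj (bK b bT)) mulmxA -[_ *m colsub K V]mulmxA.
have -> : D^T *m colsub K V = 1%:M by rewrite -[colsub K V]trmxK -trmx_mul DE trmx1.
by rewrite mulmx1 -(mul_colsubE _ Kinj (bK b bT)) mul1mx.
Qed.

(** The supporting functional is the sum of the coordinates outside [S]. *)
Lemma scone_face S T : S \subset T -> independent_cols T ->
  is_face (scone V S) (scone V T).
Proof.
move=> sST /independent_coords[L LV].
pose e : 'rV[R]_m := \row_k (k \notin S)%:R.
have yE b : supported T b ->
    ((e *m L) *m (V *m b)) 0 0 = \sum_(k | k \notin S) b k 0.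
  move=> bT; rewrite -mulmxA LV // mxE [RHS]big_mkcond; apply: eq_bigr => k _.
  by rewrite mxE; case: (k \in S); rewrite ?mul0r ?mul1r.
exists (e *m L) => [_ [b [b0 bT ->]]|]; first by rewrite yE // sumr_ge0.
apply/seteqP; split=> x.
  move=> [b [b0 bS ->]]; have bT := supported_sub sST bS.
  split; first by exists b.
  by rewrite /hyperplane /= yE // big1.
move=> [[b [b0 bT ->]]]; rewrite /hyperplane /= yE // => /eqP.
rewrite psumr_eq0 // => /allP bS; exists b; split=> // j jS.
by have := bS j (mem_index_enum j); rewrite jS => /eqP.
Qed.

Lemma scone_relint S b : independent_cols S -> supported S b ->
  (forall j, j \in S -> 0 < b j 0) -> relint (scone V S) (V *m b).
Proof.
move=> /independent_coords[L LV] bS b0.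
have bge j : 0 <= b j 0.
  by have [/b0/ltW //|/bS ->] := boolP (j \in S).
split; first by exists b.
pose mask (c : 'cV[R]_m) : 'cV[R]_m := \col_j (if j \in S then c j 0 else 0).
have maskS c : supported S (mask c) by move=> j jS; rewrite mxE (negbTE jS).
have mask_id c : supported S c -> mask c = c.
  move=> cS; apply/matrixP=> j z; rewrite ord1 mxE.
  by case: ifPn => // /cS.
pose D : 'M[R]_m := diag_mx (\row_j (j \in S)%:R).
have DE c : D *m c = mask c.
  apply/matrixP=> j z; rewrite ord1 mul_diag_mx !mxE.
  by case: (j \in S); rewrite ?mul1r ?mul0r.
pose U : {vspace 'cV[R]_d} :=
  limg (linfun (mulmx (V *m D) : 'cV[R]_m -> 'cV[R]_d)).
have UP x : x \in U <-> exists2 c, supported S c & x = V *m c.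
  split=> [/memv_imgP[c _ ->]|[c cS ->]].
    by exists (mask c) => //; rewrite lfunE /= -mulmxA DE.
  apply/memv_imgP; exists c; first exact: memvf.
  by rewrite lfunE /= -mulmxA DE mask_id.
exists U; split.
  split=> [x [c [_ cS ->]]|W VW]; first by apply/UP; exists c.
  apply/subvP => x /UP[c cS ->].
  have -> : V *m c = \sum_(j in S) c j 0 *: col j V.
    apply/matrixP=> i z; rewrite ord1 mxE summxE (bigID (mem S)) /=.
    rewrite [X in _ + X]big1 ?addr0 => [|j /cS ->]; last by rewrite mulr0.
    by apply: eq_bigr => j _; rewrite !mxE mulrC.
  by apply: memv_suml => j jS; apply/memvZ/VW/scone_col.
(* Outside [S] the value 1 is a dummy. The resulting [e] keeps [e] times the absolute row sum of [L]
   below each [b j 0] with [j] in [S]. *)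
have pos j : 0 < (if j \in S then b j 0 else 1) by case: ifP => // /b0.
have [e e0 eb] := small_shift (fun j => - \sum_i `|L j i|) pos.
exists e => // y /UP[c cS ->] yx; exists c; split=> // j.
have [jS|/cS ->//] := boolP (j \in S).
have := eb j; rewrite jS mulrN subr_gt0 => ej.
have cb : c j 0 - b j 0 = \sum_i L j i * ((V *m c) i 0 - (V *m b) i 0).
  rewrite -[in LHS](LV c cS) -[in LHS](LV b bS) [in LHS]mxE [X in _ - X]mxE.
  by rewrite -sumrB; apply: eq_bigr => i _; rewrite mulrBr.
have : `|c j 0 - b j 0| <= e * \sum_i `|L j i|.
  rewrite cb mulr_sumr; apply: le_trans (ler_norm_sum _ _ _) _.
  apply: ler_sum => i _; rewrite normrM mulrC; apply: ler_wpM2r => //.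
  exact/ltW/yx.
by rewrite ler_norml => /andP[+ _]; lra.
Qed.

End SimplicialCones.

(** * Gale duality and the cones of the fan *)

Section Fans.
Variables (R : realType) (n r : nat) (V : 'M[int]_(n, n + r)).
Variable Q : 'M[int]_(r, n + r).
Hypotheses (hV : F_matrix R V) (hQ : gale_dual V Q).
Let W : 'M[R]_(n, n + r) := map_mx intr V.
Let A : 'M[R]_(r, n + r) := map_mx intr Q.

Lemma rat_common_denominator (k : nat) (v : 'rV[rat]_k) :
  exists2 N : int, N != 0 & exists c : 'rV[int]_k, N%:~R *: v = map_mx intr c.
Proof.
exists (\prod_i denq (v 0 i)); first by apply/prodf_neq0 => i _; rewrite denq_neq0.
exists (\row_i (numq (v 0 i) * \prod_(j | j != i) denq (v 0 j))).
apply/matrixP=> z i; rewrite ord1 !mxE (bigD1 i) //= !rmorphM /= numqE.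
by rewrite mulrC mulrA.
Qed.

(** The definition excludes integer relations between rows; clearing denominators excludes rational
    ones, and rank is unchanged by extending the field to [R]. *)
Lemma gale_row_free : row_free A.
Proof.
have [_ Qinj _ _] := hQ.
have -> : A = map_mx ratr (map_mx intr Q).
  by apply/matrixP=> i j; rewrite !mxE ratr_int.
rewrite row_free_map; apply: inj_row_free => v vQ.
have [N N0 [c cE]] := rat_common_denominator v.
have c0 : c = 0.
  apply: Qinj; apply/matrixP=> i j; apply: (@intr_inj rat).
  have := congr1 (fun x : 'rV_(n + r) => x i j) (congr1 ( *:%R N%:~R) vQ).
  by rewrite scalemxAl cE -map_mxM scaler0 !mxE.
move: cE; rewrite c0 raddf0 => /eqP.
by rewrite scaler_eq0 intr_eq0 (negbTE N0) => /eqP.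
Qed.

(** The independent rows of [A] fill the kernel, whose dimension is n + r - n. Relations between the
    v_j are thus linear functionals evaluated at the q_j. *)
Lemma gale_kernel (y : 'cV[R]_(n + r)) :
  W *m y = 0 <-> exists f : 'rV[R]_r, y = (f *m A)^T.
Proof.
have [Qker _ _ _] := hQ; have [rkV _ _ _] := hV.
have WA : W *m A^T = 0.
  rewrite map_trmx -map_mxM (_ : V *m Q^T = 0) ?map_mx0 //.
  apply/trmx_inj; rewrite trmx0 trmx_mul trmxK; apply/row_matrixP => i.
  have /Qker Vi : exists c, row i Q = c *m Q by exists (delta_mx 0 i); rewrite rowE.
  by rewrite row_mul -[row i Q]trmxK -trmx_mul Vi trmx0 row0.
have AW : (A <= kermx W^T)%MS.
  by apply/sub_kermxP; rewrite -[A]trmxK -trmx_mul WA trmx0.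
have AE : (A :=: kermx W^T)%MS.
  apply/eqmxP; rewrite AW /= -(geq_leqif (mxrank_leqif_sup AW)).
  by rewrite mxrank_ker mxrank_tr rkV addKn (eqP gale_row_free).
split=> [Wy|[f ->]]; last by rewrite trmx_mul mulmxA WA mul0mx.
have : (y^T <= A)%MS.
  by rewrite AE; apply/sub_kermxP; rewrite -trmx_mul Wy trmx0.
by case/submxP=> f fE; exists f; rewrite -fE trmxK.
Qed.

(** Minus the sum of the v_j is a nonnegative combination of them; adding 1 to each coefficient
    gives a strictly positive relation. *)
Lemma gale_positive : exists g : 'rV[R]_r, forall j, 0 < (g *m A) 0 j.
Proof.
have [_ VT _ _] := hV.
have : icone R V (- (W *m const_mx 1)) by rewrite VT.
move=> [c c0 cE]; have /gale_kernel[g gE] : W *m (c + const_mx 1) = 0.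
  by rewrite mulmxDr -cE addNr.
exists g => j; have := congr1 (fun y : 'cV[R]_(n + r) => y j 0) gE.
by rewrite /= [RHS]mxE !mxE => <-; rewrite ltr_wpDl.
Qed.

Lemma nonsingular_colsP (J : {set 'I_(n + r)}) : nonsingular_cols Q J <->
  #|J| = r /\ forall f : 'rV[R]_r, (forall j, j \in J -> (f *m A) 0 j = 0) -> f = 0.
Proof.
have detE (e : #|J| = r) : \det (castmx (erefl r, e) (subcols Q J)) != 0 <->
    forall f : 'rV[R]_r, (forall j, j \in J -> (f *m A) 0 j = 0) -> f = 0.
  pose K (i : 'I_r) := enum_val (cast_ord (esym e) i).
  have -> : castmx (erefl r, e) (subcols Q J) = colsub K Q.
    by apply/matrixP=> i j; rewrite castmxE !mxE cast_ord_id.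
  have KJ i : K i \in J by exact: enum_valP.
  have JK j : j \in J -> exists i, K i = j.
    move=> jJ; exists (cast_ord e (enum_rank_in jJ j)).
    by rewrite /K cast_ordK enum_rankK_in.
  have -> : (\det (colsub K Q) != 0) = row_free (colsub K A).
    by rewrite row_free_unit unitmxE -map_mxsub det_map_mx unitfE intr_eq0.
  have fK (f : 'rV[R]_r) : f *m colsub K A = 0 <->
      forall j, j \in J -> (f *m A) 0 j = 0.
    rewrite mulmx_colsub; split=> [fA j /JK[i <-]|fA].
      by have := congr1 (fun y : 'rV[R]_r => y 0 i) fA; rewrite mxE [RHS]mxE.
    by apply/matrixP=> z i; rewrite ord1 mxE fA // mxE.
  split=> [/row_freeP[D DE] f /fK fA|Kinj].
    by rewrite -[f]mulmx1 -DE mulmxA fA mul0mx.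
  by apply: inj_row_free => f /fK /Kinj.
by split=> [[e /detE]|[e /detE]]; [split | exists e].
Qed.

(** A relation supported off [J] is a functional vanishing on the q_j with j in [J], hence zero. *)
Lemma nonsingular_independent (J : {set 'I_(n + r)}) : nonsingular_cols Q J ->
  independent_cols W (~: J).
Proof.
move=> /nonsingular_colsP[_ Jinj] b bJ /gale_kernel[f fE].
rewrite fE (_ : f = 0) ?mul0mx ?trmx0 //; apply: Jinj => j jJ.
have := congr1 (fun y : 'cV[R]_(n + r) => y j 0) fE.
by rewrite [RHS]mxE => <-; apply: bJ; rewrite inE jJ.
Qed.

Lemma rayE j : ray R V j = scone W [set j]%SET.
Proof.
rewrite /ray /icone map_col; apply/seteqP; split=> x.
  move=> [c c0 ->]; exists (c 0 0 *: delta_mx j 0); split=> [k|k|].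
  - by rewrite !mxE; case: (_ && _); rewrite ?mulr1 ?mulr0.
  - by rewrite !inE => /negbTE kj; rewrite !mxE kj mulr0.
  - by rewrite [c]mx11_scalar mul_mx_scalar mxE eqxx mulr1n colE scalemxAr.
move=> [c [c0 cj ->]]; exists (const_mx (c j 0)) => [k|]; first by rewrite mxE.
apply/matrixP=> i z; rewrite ord1 !mxE big_ord1 !mxE (bigD1 j) //=.
rewrite big1 ?addr0 ?mxE // => k kj.
by rewrite cj ?mulr0 // inE.
Qed.

Lemma ray_sub (S : {set 'I_(n + r)}) j : j \in S -> ray R V j `<=` scone W S.
Proof. by move=> jS; rewrite rayE; apply: scone_sub; rewrite finset.sub1set. Qed.

Lemma col_ray j : ray R V j (col j W).
Proof. by rewrite rayE; apply: scone_col; rewrite inE. Qed.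

Lemma colW_neq0 j : col j W != 0.
Proof.
have [_ _ /(_ j) Vj _] := hV; apply: contra Vj => /eqP Wj; apply/eqP.
apply/matrixP=> i z; have := congr1 (fun y : 'cV[R]_n => y i z) Wj.
by rewrite !mxE => /eqP; rewrite intr_eq0 => /eqP.
Qed.

(** If the ray of v_j is a face, any v_k occurring in an expression of v_j lies on that face too, so
    it is a positive multiple of v_j and k = j. *)
Lemma rays_of_scone (S : {set 'I_(n + r)}) : independent_cols W S ->
  rays_of V (scone W S) = S.
Proof.
move=> Sind; apply/finset.setP=> j; rewrite inE; apply/asboolP/idP => [[f f0 fE]|jS].
  have := col_ray j; rewrite fE => -[[b [b0 bS bE]]].
  rewrite /hyperplane /= bE (supported_mulmx _ _ bS) => /eqP.
  rewrite psumr_eq0 => [/allP fb|k kS]; last first.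
    by rewrite mulr_ge0 // -pairing_colE f0 //; apply: scone_col.
  have [k bk] : exists k, b k 0 != 0.
    apply: contrapT => nok; case/eqP: (colW_neq0 j); rewrite bE.
    rewrite (_ : b = 0) ?mulmx0 //; apply/matrixP=> k z; rewrite ord1 mxE.
    by apply/eqP/negPn/negP => bk; apply: nok; exists k.
  have kS : k \in S by apply: contraNT bk => /bS ->.
  have : ray R V j (col k W).
    rewrite fE; split; first exact: scone_col.
    have := fb k (mem_index_enum k).
    by rewrite kS mulf_eq0 (negbTE bk) orbF /hyperplane /= pairing_colE => /eqP.
  rewrite rayE => -[c [c0 cj cE]].
  have {}cE : col k W = c j 0 *: col j W.
    rewrite cE colE scalemxAr; congr (_ *m _); apply/matrixP=> i z.
    rewrite ord1 !mxE andbT; have [->|ij] := eqVneq i j; first by rewrite mulr1.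
    by rewrite mulr0 cj // inE.
  have [_ _ _ Vprop] := hV; have [->//|kj] := eqVneq j k.
  rewrite eq_sym in kj; case: (Vprop k j kj); exists (c j 0); last first.
    by rewrite !map_col.
  rewrite lt0r c0 andbT; apply: contraNneq (colW_neq0 k) => cj0.
  by rewrite cE cj0 scale0r.
rewrite rayE; apply: scone_face => //.
by rewrite finset.sub1set.
Qed.

End Fans.

(** * The primitive collections are the classes *)

Section PrimitiveCollections.
Variables (R : realType) (n s : nat) (V : 'M[int]_(n, n + s.+1)).
Variables (Q : 'M[int]_(s.+1, n + s.+1)) (gamma : set 'cV[R]_s.+1).
Hypotheses (hV : F_matrix R V) (hQ : gale_dual V Q) (gammaP : chamber Q gamma).
Hypothesis hmov : gamma `<=` mov R Q.
Let W : 'M[R]_(n, n + s.+1) := map_mx intr V.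
Let A : 'M[R]_(s.+1, n + s.+1) := map_mx intr Q.
Variables (u : 'rV[R]_s.+1) (w : 'cV[R]_s.+1).
Variables (cl : 'I_(n + s.+1) -> 'I_s.+1) (k0 : 'I_s -> 'I_(n + s.+1)).
Hypothesis u0 : u != 0.
Hypothesis uA : forall j, 0 <= (u *m A) 0 j.
Hypothesis gw : gamma w.
Hypothesis facetP : facet_classes A u w cl k0.
Let Sigma := fan V Q gamma.

(** [J] consists of one column outside [P] from each class. *)
Lemma chamber_avoiding (P : {set 'I_(n + s.+1)}) : gamma `<=` scone A (~: P) ->
  exists J, [/\ nonsingular_cols Q J, gamma `<=` icone R (subcols Q J)
    & P \subset ~: J].
Proof.
move=> /(chamber_sconeP gammaP u0 uA gw facetP)/fin_all_exists2[K KP clK].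
have Kinj : injective K by move=> i i' Kii; rewrite -(clK i) Kii clK.
exists [set K i | i in 'I_s.+1]%SET; split.
- apply/(nonsingular_colsP R); split; first by rewrite card_imset ?card_ord.
  have := section_unit uA facetP clK; rewrite -row_free_unit => /row_freeP[D DE] f fK.
  rewrite -[f]mulmx1 -DE mulmxA mulmx_colsub (_ : colsub K _ = 0) ?mul0mx //.
  by apply/matrixP=> z i; rewrite ord1 mxE [RHS]mxE; apply/fK/imset_f.
- rewrite icone_subcols -cone_colsub //.
  exact: (section_chamber gammaP u0 uA gw facetP).
- apply/fintype.subsetP => j jP; rewrite inE; apply/imsetP => -[i _ ji].
  by have := KP i; rewrite inE -ji jP.
Qed.

(* If v_j, with j in J, were in the cone of the complement of J, the relation
   expressing it would be a functional which is 1 at q_j and nonpositive at the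
   other columns: it is nonpositive on gamma since gamma lies in Mov(V), and
   nonnegative since gamma lies in the cone of J. *)
Lemma ray_not_in_cone (J : {set 'I_(n + s.+1)}) j :
  gamma `<=` scone A J -> scone W (~: J) (col j W) -> j \notin J.
Proof.
move=> gJ [c [c0 cJ cE]]; apply/negP => jJ.
have /(gale_kernel hV hQ)[f fE] : W *m (delta_mx j 0 - c) = 0.
  by rewrite mulmxBr -colE cE subrr.
have fA k : (f *m A) 0 k = (k == j)%:R - c k 0.
  have := congr1 (fun y : 'cV[R]_(n + s.+1) => y k 0) fE.
  by rewrite [RHS]mxE => <-; rewrite !mxE andbT.
have cJ0 k : k \in J -> c k 0 = 0 by move=> kJ; apply: cJ; rewrite inE kJ.
have [_ gd _] := gammaP.
suff f0 : f = 0.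
  by have := fA j; rewrite f0 mul0mx mxE eqxx cJ0 // subr0 => /esym/eqP; rewrite oner_eq0.
apply: (vanishing_full gd) => x gx; apply: le_anti; apply/andP; split.
  have : icone R (subcols Q (~: [set j]%SET)) x by apply: hmov gx _ _.
  rewrite icone_subcols => -[b [b0 bj ->]].
  rewrite pairing_mulE; apply: sumr_le0 => k _; rewrite fA.
  have [->|kj] := eqVneq k j; first by rewrite bj ?mulr0 // !inE eqxx.
  by rewrite sub0r mulNr oppr_le0 mulr_ge0.
have [b [b0 bJ ->]] := gJ _ gx.
rewrite pairing_mulE; apply: sumr_ge0 => k _; rewrite fA.
have [kJ|/bJ ->] := boolP (k \in J); last by rewrite mulr0.
by rewrite cJ0 // subr0 mulr_ge0.
Qed.

Lemma in_one_coneP (P : {set 'I_(n + s.+1)}) :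
  in_one_cone V Sigma P <-> gamma `<=` scone A (~: P).
Proof.
split=> [[sigma [J [_ gJ sigmaJ]] Psigma]|/chamber_avoiding[J [Jns gJ PJ]]].
  rewrite icone_subcols in gJ; apply: (subset_trans gJ); apply: scone_sub.
  apply/fintype.subsetP => j jJ; rewrite inE; apply: contraL jJ => jP.
  apply: (ray_not_in_cone gJ); rewrite -icone_subcols.
  have [f _ sE] := sigmaJ; have := Psigma j jP _ (col_ray R V j).
  by rewrite sE => -[].
exists (scone W (~: J)) => [|j jP]; last by apply: ray_sub; exact: (fintype.subsetP PJ).
exists J; split=> //; rewrite icone_subcols; apply: scone_face => //.
exact: (nonsingular_independent hV hQ).
Qed.

Lemma in_one_cone_class (P : {set 'I_(n + s.+1)}) :
  in_one_cone V Sigma P <-> forall i, exists2 j, j \notin P & cl j = i.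
Proof.
rewrite in_one_coneP (chamber_sconeP gammaP u0 uA gw facetP).
by split=> PK i; have [j jP clj] := PK i; exists j => //; rewrite inE in jP *.
Qed.

Let class i := [set j | cl j == i]%SET.

Lemma class_neq0 i : exists j, cl j = i.
Proof.
have [j _ clj] : exists2 j, j \in [set: 'I_(n + s.+1)]%SET & cl j = i.
  apply: (chamber_meets gammaP u0 uA gw facetP).
  by rewrite scone_setT; exact: chamber_cone.
by exists j.
Qed.

(** A set lies in one cone exactly when it contains no whole class, and the classes are nonempty and
    disjoint; hence they are the minimal sets in no cone. *)
Lemma primitive_collectionP (P : {set 'I_(n + s.+1)}) :
  primitive_collection V Sigma P <-> exists i, P = class i.
Proof.
have notin i : ~ in_one_cone V Sigma (class i).
  by move=> /in_one_cone_class/(_ i)[j]; rewrite inE => /eqP.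
split=> [[nP Pmin]|[i ->]].
  have [i iP] : exists i, class i \subset P.
    apply: contrapT => noi; apply/nP/in_one_cone_class => i.
    apply: contrapT => noj; apply: noi; exists i.
    apply/fintype.subsetP => j; rewrite inE => /eqP clj.
    by apply/negPn/negP => jP; apply: noj; exists j.
  exists i; apply/eqP; rewrite finset.eqEsubset iP andbT.
  apply/negPn/negP => Pi; apply: (notin i); apply: Pmin.
  by rewrite properE iP.
split=> // P' /properP[P'i [j ji jP']]; apply/in_one_cone_class => i'.
have [->|ii'] := eqVneq i' i; first by exists j => //; move: ji; rewrite inE => /eqP.
have [k clk] := class_neq0 i'; exists k => //.
apply: contra ii' => /(fintype.subsetP P'i).
by rewrite inE clk.
Qed.

Lemma card_primitive_collections :
  #|[set P : {set 'I_(n + s.+1)} |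
      `[< primitive_collection V Sigma P >]]%SET| = s.+1.
Proof.
have -> : [set P : {set 'I_(n + s.+1)} |
    `[< primitive_collection V Sigma P >]]%SET = [set class i | i in 'I_s.+1]%SET.
  apply/finset.setP=> P; rewrite inE; apply/asboolP/imsetP.
    by move=> /primitive_collectionP[i ->]; exists i.
  by move=> [i _ ->]; apply/primitive_collectionP; exists i.
rewrite card_imset ?card_ord // => i i' /finset.setP ii'.
have [j clj] := class_neq0 i; have := ii' j; rewrite !inE clj eqxx.
by move=> /esym/eqP.
Qed.

End PrimitiveCollections.

(** * The class off the facet is nef *)

Section Nef.
Variables (R : realType) (n s : nat) (V : 'M[int]_(n, n + s.+1)).
Variables (Q : 'M[int]_(s.+1, n + s.+1)) (gamma : set 'cV[R]_s.+1).
Hypotheses (hV : F_matrix R V) (hQ : gale_dual V Q) (gammaP : chamber Q gamma).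
Let W : 'M[R]_(n, n + s.+1) := map_mx intr V.
Let A : 'M[R]_(s.+1, n + s.+1) := map_mx intr Q.
Variables (u : 'rV[R]_s.+1) (w : 'cV[R]_s.+1).
Variables (cl : 'I_(n + s.+1) -> 'I_s.+1) (k0 : 'I_s -> 'I_(n + s.+1)).
Hypothesis u0 : u != 0.
Hypothesis uA : forall j, 0 <= (u *m A) 0 j.
Hypothesis gw : gamma w.
Hypothesis facetP : facet_classes A u w cl k0.
Hypothesis facet_dim : has_dim (hyperplane u `&` icone R Q) s.

Lemma annihilator_scale (d : nat) (f g : 'rV[R]_d) : g != 0 ->
  (forall x : 'cV[R]_d, (g *m x) 0 0 = 0 -> (f *m x) 0 0 = 0) -> exists a, f = a *: g.
Proof.
move=> g0 fg; have [i gi] : exists i, g 0 i != 0.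
  apply: contrapT => noi; case/eqP: g0; apply/matrixP=> z i; rewrite ord1 mxE.
  by apply/eqP/negPn/negP => gi; apply: noi; exists i.
exists (f 0 i / g 0 i); apply/matrixP=> z j; rewrite ord1 [RHS]mxE.
have e (h : 'rV[R]_d) k : (h *m delta_mx k (0 : 'I_1)) 0 0 = h 0 k.
  by rewrite -colE mxE.
have := fg (delta_mx j 0 - (g 0 j / g 0 i) *: delta_mx i 0).
rewrite !pairingBr !pairingZr !e divfK // subrr => /(_ erefl) /eqP.
by rewrite subr_eq0 => /eqP ->; field.
Qed.

(* The facet is spanned by integral columns, so u is rational up to scaling. *)
Lemma facet_rational p : 0 < (u *m A) 0 p -> exists a : 'I_(n + s.+1) -> rat,
  forall j, ratr (a j) = (u *m A) 0 j / (u *m A) 0 p.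
Proof.
(* [B] keeps the columns on the facet and replaces the others by zero. As [u] annihilates it over
   [R], it also has a nonzero rational left kernel vector. *)
move=> up; pose B : 'M[rat]_(s.+1, n + s.+1) :=
  \matrix_(i, j) (if (u *m A) 0 j == 0 then (Q i j)%:~R else 0).
have B0 i j : (u *m A) 0 j = 0 -> ratr (B i j) = A i j :> R.
  by move=> uj; rewrite [B i j]mxE uj eqxx ratr_int mxE.
have uB : u *m map_mx ratr B = 0.
  apply/matrixP=> z j; rewrite ord1 [RHS]mxE mxE.
  have [uj|uj] := eqVneq ((u *m A) 0 j) 0.
    rewrite -[RHS]uj mxE; apply: eq_bigr => i _.
    by rewrite [X in _ * X]mxE B0.
  rewrite big1 // => i _; rewrite [X in _ * X]mxE [B i j]mxE (negbTE uj).
  by rewrite raddf0 mulr0.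
have : kermx B != 0.
  rewrite kermx_eq0 -(row_free_map (ratr : rat -> R)); apply: contra u0.
  by move=> /row_freeP[D DE]; rewrite -[u]mulmx1 -DE mulmxA uB mul0mx.
rewrite -nz_row_eq0; set v := nz_row _ => v0.
have vB : v *m B = 0 by apply/sub_kermxP; exact: nz_row_sub.
pose f : 'rV[R]_s.+1 := map_mx ratr v.
have fcol j : (u *m A) 0 j = 0 -> (f *m A) 0 j = 0.
  move=> uj; have := congr1 (fun x : 'rV[rat]_(n + s.+1) => ratr (x 0 j) : R) vB.
  rewrite [in RHS]mxE raddf0 => <-; rewrite [in RHS]mxE mxE rmorph_sum /=.
  by apply: eq_bigr => i _; rewrite [f 0 i]mxE rmorphM /= B0.
(* The facet spans the hyperplane [u = 0], so [f] vanishes on it. *)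
have [a fE] : exists a, f = a *: u.
  apply: annihilator_scale => // x ux.
  have [_ Umin] : is_linear_span (icone R Q `&` hyperplane u) (annihilator u).
    by apply: span_annihilator => //; rewrite setIC.
  have /subvP/(_ x) : (annihilator u <= annihilator f)%VS.
    apply: Umin => y [[c c0 ->]] /= uy.
    rewrite mem_annihilator pairing_mulE big1 // => j _.
    have [->|cj] := eqVneq (c j 0) 0; first by rewrite mulr0.
    by rewrite fcol ?mul0r //; exact: (facet_support uA c0 uy cj).
  by rewrite !mem_annihilator ux eqxx => /(_ isT)/eqP.
have a0 : a != 0.
  apply: contraNneq v0 => a0; rewrite -(map_mx_eq0 (ratr : rat -> R)) -/f fE a0.
  by rewrite scale0r.
pose b := v *m map_mx intr Q.
have bE j : ratr (b 0 j) = a * (u *m A) 0 j.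
  have -> : a * (u *m A) 0 j = (f *m A) 0 j by rewrite fE -scalemxAl [RHS]mxE.
  rewrite !mxE rmorph_sum; apply: eq_bigr => i _.
  by rewrite !mxE rmorphM /= ratr_int.
exists (fun j => b 0 j / b 0 p) => j.
rewrite fmorph_div /= !bE.
by rewrite invfM mulrACA divff // mul1r.
Qed.

(* The relation sum_j (u q_j) v_j = 0, scaled so that its largest coefficient
   is 1, is subtracted from the sum of the v_j with u q_j > 0. *)
Lemma facet_nef : nef_collection V (fan V Q gamma) [set j | cl j == 0]%SET.
Proof.
have [j0 clj0] := class_neq0 gammaP u0 uA gw facetP 0.
have cl0 := facet_class0 uA facetP.
have [p _ pmax] := Order.TotalTheory.arg_maxP
  (i0 := j0) (P := xpredT) (fun j => (u *m A) 0 j) isT.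
have up : 0 < (u *m A) 0 p.
  by apply: lt_le_trans (pmax j0 _) => //; rewrite -cl0 clj0.
have [a aE] := facet_rational up.
have a_ge0 j : 0 <= a j.
  by rewrite -(ler0q R) aE divr_ge0 // ltW.
have a_le1 j : a j <= 1.
  by rewrite -(ler_rat R) aE rmorph1 ler_pdivrMr // mul1r; exact: pmax.
have ap : a p = 1.
  by apply: (fmorph_inj (ratr : rat -> R)); rewrite /= aE rmorph1 divff // gt_eqF.
have acl j : (cl j == 0) = (0 < a j).
  by rewrite cl0 -(ltr0q R) aE pmulr_lgt0 // invr_gt0.
(* Columns with [a j = 1] cancel from the sum, so the remainder, with coefficients [1 - a j], lives
   exactly on [S]. It lies in one cone: [S] misses [p] in class 0 and every other class entirely. *)
pose S := [set j | 0 < a j < 1]%SET.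
have [J [Jns gJ SJ]] : exists J, [/\ nonsingular_cols Q J,
    gamma `<=` icone R (subcols Q J) & S \subset ~: J].
  apply: (chamber_avoiding gammaP u0 uA gw facetP).
  apply/(chamber_sconeP gammaP u0 uA gw facetP) => i.
  have [->|i0] := eqVneq i 0.
    by exists p; [rewrite !inE ap ltxx andbF | apply/eqP; rewrite cl0].
  have [j clj] := class_neq0 gammaP u0 uA gw facetP i; exists j => //.
  by rewrite !inE -acl clj (negbTE i0).
have Jind := nonsingular_independent hV hQ Jns.
have Sind : independent_cols W S.
  by move=> b bS; apply: Jind; exact: supported_sub bS.
pose b : 'cV[R]_(n + s.+1) := \col_j (if j \in S then 1 - ratr (a j) else 0).
have bS : supported S b by move=> j /negbTE jS; rewrite mxE jS.
have sumE : \sum_(j in [set j | cl j == 0]%SET) col j W = W *m b.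
  have -> : \sum_(j in [set j | cl j == 0]%SET) col j W =
      W *m \col_j (cl j == 0)%:R.
    apply/matrixP=> i z; rewrite ord1 summxE mxE big_mkcond; apply: eq_bigr => j _.
    by rewrite !mxE inE; case: (_ == _); rewrite ?mulr1 ?mulr0.
  (* The indicator of class 0 minus [b] is [a], the relation given by [u] divided by its value at
     [p]. *)
  apply/eqP; rewrite -subr_eq0 -mulmxBr; apply/eqP/(gale_kernel hV hQ).
  exists (((u *m A) 0 p)^-1 *: u); apply/matrixP=> j z.
  rewrite ord1 -scalemxAl [RHS]mxE [RHS]mxE mulrC -aE !mxE inE acl.
  have [a0|a0] := ltrP 0 (a j); last first.
    by rewrite subr0 (_ : a j = 0) ?raddf0 //; apply/le_anti; rewrite a0 a_ge0.
  have [a1|a1] := ltrP (a j) 1; first by rewrite opprB addrC subrK.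
  by rewrite subr0 (_ : a j = 1) ?rmorph1 //; apply/le_anti; rewrite a1 a_le1.
have raysS : rays_of V (scone W S) = S := rays_of_scone hV Sind.
exists a; last exact: a_ge0.
exists (scone W S), (fun j => 1 - a j).
have colV j : map_mx intr (col j V) = col j W by rewrite map_col.
split.
- by exists J; split=> //; rewrite icone_subcols; apply: scone_face.
- rewrite (eq_bigr _ (fun j _ => colV j)) sumE; apply: scone_relint => // j jS.
  rewrite mxE jS subr_gt0 -(rmorph1 (ratr : rat -> R)) ltr_rat.
  by move: jS; rewrite inE => /andP[].
- by move=> j; rewrite raysS inE subr_gt0 => /andP[].
- rewrite raysS (eq_bigr _ (fun j _ => colV j)) sumE; apply/eqP.
  rewrite subr_eq0; apply/eqP/matrixP=> i z; rewrite ord1 mxE summxE.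
  rewrite (bigID (mem S)) /= [X in _ + X]big1 ?addr0 => [|j /bS ->]; last first.
    by rewrite mulr0.
  apply: eq_bigr => j jS; rewrite colV !mxE jS mulrC.
  by rewrite rmorphB rmorph1.
- move=> j; rewrite raysS !inE acl.
  have [a0|a0] := ltrP 0 (a j); last by rewrite subr0; apply/le_anti; rewrite a0 a_ge0.
  have [a1|a1] := ltrP (a j) 1; first by rewrite opprB addrC subrK.
  by rewrite subr0; apply/le_anti; rewrite a1 a_le1.
Qed.

End Nef.

Lemma facet_classes_exist (R : realType) (s m : nat) (Q : 'M[int]_(s.+1, m))
    (gamma : set 'cV[R]_s.+1) (g u : 'rV[R]_s.+1) :
  (s <= 2)%N -> chamber Q gamma ->
  (forall j, 0 < (g *m map_mx intr Q) 0 j) ->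
  (forall j, 0 <= (u *m map_mx intr Q) 0 j) -> u != 0 ->
  has_dim (gamma `&` hyperplane u) s ->
  exists (w : 'cV[R]_s.+1) cl k0,
    gamma w /\ facet_classes (map_mx intr Q) u w cl k0.
Proof.
case: s Q gamma g u => [|[|[|//]]] Q gamma g u _ gammaP gA uA u0 gd.
- exact: facet_classes_point gammaP gA u0.
- exact: facet_classes_ray gammaP gA uA u0 gd.
- exact (facet_classes_pencil gammaP gA uA u0 gd).
Qed.

Theorem theorem2p33 (R : realType) (n r : nat) (V : 'M[int]_(n, n + r))
    (Q : 'M[int]_(r, n + r)) (gamma : set 'cV[R]_r)
    (hV : F_matrix R V) (hred : reduced V) (hr : (r <= 3)%N)
    (hQ : gale_dual V Q) (hgamma : chamber Q gamma)
    (hmov : gamma `<=` mov R Q) (hmax : maxbord Q gamma) :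
  [/\ simplicial gamma,
      #|[set P : {set 'I_(n + r)} |
          `[< primitive_collection V (fan V Q gamma) P >]]%SET| = r
    & exists2 P : {set 'I_(n + r)},
        primitive_collection V (fan V Q gamma) P &
        nef_collection V (fan V Q gamma) P].
Proof.
case: r V Q gamma hV hred hr hQ hgamma hmov hmax => [|s] {}V {}Q {}gamma.
  (* For r = 0 there is no nonzero [u], so no chamber is maxbord. *)
  by move=> _ _ _ _ _ _ [u [/eqP[]]]; apply/matrixP=> i [].
move=> FV _ s2 galeQ gammaP gmov [u [u0 uQ facet_dim gd]].
have uA j : 0 <= (u *m map_mx intr Q) 0 j.
  rewrite -pairing_colE; apply: uQ; rewrite /icone -scone_setT.
  by apply: scone_col; rewrite inE.
have [g gA] := gale_positive FV galeQ.
have [w [cl [k0 [gw facetP]]]] := facet_classes_exist s2 gammaP gA uA u0 gd.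
split.
- exact (chamber_simplicial gammaP u0 uA gw facetP).
- exact (card_primitive_collections FV galeQ gammaP gmov u0 uA gw facetP).
- exists [set j | cl j == 0]%SET; last first.
  exact (facet_nef FV galeQ gammaP u0 uA gw facetP facet_dim).
  apply/(primitive_collectionP FV galeQ gammaP gmov u0 uA gw facetP).
  by exists 0.
Qed.
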